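(* Let $Z\subset\mathbb{P}^2_{\mathbb{C}}$ be an irreducible projective curve that is not a line through $[0:0:1]$ and is not the line at infinity $\{w=0\}$. Let $f(u,v)\in\mathbb{C}[u,v]$ be an irreducible polynomial of degree $n$ such that $f(u,v)=0$ is a defining equation for the affine curve $X=Z\setminus\mathbf{V}(w)\subset\mathbb{C}^2$. Then $$\widetilde{\alpha}(Z)=\bigcup_{k=1}^n\partial S_f(k).$$
   Context: $\mathbb{R}^3$ is identified with $\mathbb{R}\times\mathbb{C}$ by $(x,y,z)\mapsto(x,y+iz)$, and $\mathbb{C}^2$ with the chart $w=1$ of $\mathbb{P}^2_{\mathbb{C}}$ (coordinates $[u:v:w]$). $B\subset\mathbb{R}^3$ is the open ball of radius $\frac12$ centered at $(\frac12,0,0)$, i.e. $B=\{(x,y,z): x-x^2-y^2-z^2>0\}$. The map $\widetilde\alpha:\mathbb{P}^2_{\mathbb{C}}\to\overline{B}\subset\mathbb{R}^3$ is $\widetilde{\alpha}([u:v:w])=\left(\frac{|u|^2}{|u|^2+|v|^2+|w|^2},\frac{\overline{u}v}{|u|^2+|v|^2+|w|^2}\right)$. For $\mathbf{p}=(x,y,z)\in B$ and $\lambda\in\mathbb{C}$, $\beta(\mathbf{p},\lambda)=\left(\frac{x\lambda}{\sqrt{x-x^2-y^2-z^2}},\frac{(y+iz)\lambda}{\sqrt{x-x^2-y^2-z^2}}\right)\in\mathbb{C}^2$. $N_f(\mathbf{p})$ is the number of zeros, counted with multiplicity, of the polynomial $\lambda\mapsto f(\beta(\mathbf{p},\lambda))$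 in the open unit disk $|\lambda|<1$ (this polynomial is not identically zero since $X$ is not a line through the origin). For $k\in\{1,\dots,n\}$, $S_f(k)=\{\mathbf{p}\in B:N_f(\mathbf{p})<k\}$, and $\partial S_f(k)$ is its topological boundary in $\mathbb{R}^3$. *)

(* Defs.v *)
From HB Require Import structures.
From mathcomp Require Import all_boot all_order all_algebra.
From mathcomp Require Import generic_quotient.
From mathcomp Require Import all_classical all_reals all_analysis.
From mathcomp Require Import complex.
(* The notations of mpoly clash with those of MathComp-Analysis. *)
From mathcomp.multinomials Require Import -(notations) mpoly.

Set Implicit Arguments.
Unset Strict Implicit.
Unset Printing Implicit Defensive.

Import Order.TTheory GRing.Theory Num.Theory.
Import numFieldNormedType.Exports.

Local Open Scope classical_set_scope.
Local Open Scope complex_scope.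
Local Open Scope quotient_scope.
Local Open Scope ring_scope.

Definition irreducible_elt (A : idomainType) (a : A) : Prop :=
  [/\ a != 0, a \isn't a GRing.unit &
      forall b c : A, a = b * c -> b \is a GRing.unit \/ c \is a GRing.unit].

Definition triple (T : Type) (a b c : T) : 'rV[T]_3 :=
  \row_(i < 3) tnth [tuple a; b; c] i.

Section ProjectivePlane.
Variable K : fieldType.

Definition nonzero3 : Type := {x : 'rV[K]_3 | x != 0}.

Definition proportional (x y : nonzero3) : bool :=
  `[< exists2 c : K, c != 0 & val y = c *: val x >].

Lemma proportional_refl : reflexive proportional.
Proof. by move=> x; apply/asboolP; exists 1; rewrite ?oner_neq0 ?scale1r. Qed.

Lemma proportional_sym : ssrbool.symmetric proportional.
Proof.
have imp x y : proportional x y -> proportional y x.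
  move=> /asboolP[c c0 e]; apply/asboolP; exists c^-1; rewrite ?invr_eq0//.
  by rewrite e scalerA mulVf// scale1r.
by move=> x y; apply/idP/idP; exact: imp.
Qed.

Lemma proportional_trans : transitive proportional.
Proof.
move=> y x z /asboolP[c c0 ey] /asboolP[d d0 ez]; apply/asboolP.
by exists (d * c); rewrite ?mulf_neq0// ez ey scalerA.
Qed.

Canonical proportional_equiv :=
  EquivRel proportional proportional_refl proportional_sym proportional_trans.

Definition P2 : Type := {eq_quot proportional_equiv}.
HB.instance Definition _ := EqQuotient.on P2.
HB.instance Definition _ := Choice.on P2.

(* [zero_locus F] is the usual V(F) when F is homogeneous, the only case in
   which it is used. *)
Definition zero_locus (F : mpoly 3 K) : set P2 :=
  [set P | forall x : nonzero3,
     \pi_P2 x = P -> meval (fun i => val x 0 i) F = 0].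

Definition irreducible_projective_curve (Z : set P2) : Prop :=
  exists (d : nat) (F : mpoly 3 K),
    [/\ F \is ishomog1 d mdeg,
        irreducible_elt F & Z = zero_locus F].

Definition projective_line (L : set P2) : Prop :=
  exists2 a : 'rV[K]_3, a != 0 &
    L = zero_locus (\sum_(i < 3) a 0 i *: mpolyX K (mnm1 i)).

Definition line_at_infinity : set P2 :=
  zero_locus (mpolyX K (mnm1 (ord_max : 'I_3))).

Lemma triple1_neq0 (u v : K) : triple u v 1 != 0.
Proof.
by apply/eqP => /rowP/(_ ord_max)/eqP; rewrite !mxE (tnth_nth 0)/= oner_eq0.
Qed.

Definition affine_chart (q : K * K) : P2 :=
  \pi_P2 (exist (fun x : 'rV[K]_3 => x != 0) _ (triple1_neq0 q.1 q.2)).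

Definition affine_point (q : K * K) : 'I_2 -> K := tnth [tuple q.1; q.2].

Definition affine_zero_set (f : mpoly 2 K) : set (K * K) :=
  [set q | meval (affine_point q) f = 0].

End ProjectivePlane.

Section Alpha.
Variable R : realType.
Local Notation C := R[i].
Local Notation R3 := (R * R * R)%type.

Definition R3_of (x : C) (c : C) : R3 :=
  (complex.Re x, complex.Re c, complex.Im c).

Definition alpha_hom (x : 'rV[C]_3) : R3 :=
  let u := x 0 0 in let v := x 0 1 in let w := x 0 ord_max in
  let s := `|u| ^+ 2 + `|v| ^+ 2 + `|w| ^+ 2 in
  R3_of (`|u| ^+ 2 / s) (u^* * v / s).

Lemma alpha_hom_scale (c : C) (x : 'rV[C]_3) :
  c != 0 -> alpha_hom (c *: x) = alpha_hom x.
Proof.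
move=> c0; have n0 : `|c| ^+ 2 != 0 by rewrite expf_neq0// normr_eq0.
rewrite /alpha_hom !mxE !normrM !exprMn -!mulrDr.
rewrite -mulf_div divff// mul1r.
suff -> : (c * x 0 0)^* * (c * x 0 1) = `|c| ^+ 2 * ((x 0 0)^* * x 0 1).
  by rewrite -mulf_div divff// mul1r.
by rewrite rmorphM normCKC mulrACA.
Qed.

Definition alpha_tilde (P : P2 C) : R3 := alpha_hom (val (repr P)).

Lemma alpha_tilde_pi (x : nonzero3 C) :
  alpha_tilde (\pi_(P2 C) x) = alpha_hom (val x).
Proof.
rewrite /alpha_tilde; have /eqmodP/asboolP[c c0 ->] : 
    repr (\pi_(P2 C) x) = x %[mod P2 C] by rewrite reprK.
by rewrite alpha_hom_scale.
Qed.

Definition ball_fun (p : R3) : R :=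
  let: (x, y, z) := p in x - x ^+ 2 - y ^+ 2 - z ^+ 2.

Definition openB : set R3 := [set p | 0 < ball_fun p].

Definition beta_dir (p : R3) : C * C :=
  let: (x, y, z) := p in
  let r := Num.sqrt (ball_fun p) in (x%:C / r%:C, (y +i* z) / r%:C).

Definition beta (p : R3) (l : C) : C * C :=
  let: (x, y, z) := p in
  let r := Num.sqrt (ball_fun p) in (x%:C * l / r%:C, (y +i* z) * l / r%:C).

(* The polynomial l |-> f (beta p l), see [horner_beta_poly]. *)
Definition beta_poly (f : mpoly 2 C) (p : R3) : {poly C} :=
  mmap polyC (fun i => affine_point (beta_dir p) i *: 'X) f.

Lemma horner_beta_poly (f : mpoly 2 C) (p : R3) (l : C) :
  (beta_poly f p).[l] = meval (affine_point (beta p l)) f.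
Proof.
rewrite /beta_poly /meval /mmap horner_sum.
apply: eq_bigr => m _; rewrite hornerM hornerC; congr (_ * _).
rewrite /mmap1 horner_prod; apply: eq_bigr => i _.
rewrite horner_exp hornerZ hornerX; congr (_ ^+ _).
case: p => [[x y] z]; rewrite /affine_point !(tnth_nth 0).
by case: i => -[|[|//]] ? /=; rewrite mulrAC.
Qed.

Definition Nf (f : mpoly 2 C) (p : R3) : nat :=
  \big[addn/0%N]_(l \in [set l : C | `|l| < 1]) mup l (beta_poly f p).

Definition Sf (f : mpoly 2 C) (k : nat) : set R3 :=
  [set p | openB p /\ (Nf f p < k)%N].

End Alpha.

Definition boundary (T : topologicalType) (A : set T) : set T :=
  closure A `\` interior A.

(* Main.v *)
(* On the open ball B, p is the image under alpha of the affine point (u, v)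
   exactly when (u, v) = beta p l for some l on the unit circle. So alpha(Z)
   meets B in the points p for which l |-> f (beta p l) has a root on the
   circle. Off these points N_f is locally constant by Hurwitz's theorem (proved
   by deflation), so they contain the part of the boundaries inside B.
   Conversely, multiplying p by t > 1 amounts to dilating the disk, which brings
   the roots on the circle strictly inside, so N_f jumps at such a p.
   On the sphere, homogenizing f rescales the polynomials continuously into
   f_n (x, y + iz) l^n, which has all its n roots at 0 unless the top degree
   part f_n vanishes; hence a boundary point of S_f k other than the origin
   comes from a point at infinity of Z. Conversely, since Z is neither the line
   at infinity nor the line u = 0, its points with u w = 0 are limits of points
   with u w != 0, and the union of the boundaries is closed. *)
Require Import Defs.
From mathcomp Require Import all_boot all_order all_algebra.
From mathcomp Require Import all_classical all_reals all_analysis.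
From mathcomp Require Import complex.
From mathcomp.multinomials Require Import -(notations) mpoly.
From mathcomp Require Import ring lra.
Import Order.TTheory GRing.Theory Num.Theory.
Import numFieldNormedType.Exports.
Local Open Scope classical_set_scope.
Local Open Scope ring_scope.

Set Implicit Arguments.
Unset Strict Implicit.
Unset Printing Implicit Defensive.

(** * Counting roots in the unit disk *)

Section DiskCount.
Variable K : numClosedFieldType.
Implicit Types (p q : {poly K}) (r : seq K).

(** [Nf f p] unfolds to [disk_count (beta_poly f p)], so what is proved here about one-variable
    polynomials applies to it directly. *)
Definition disk_count p : nat :=
  \big[addn/0%N]_(l \in [set l : K | `|l| < 1]) mup l p.

Lemma prod_XsubC_neq0 r : \prod_(z <- r) ('X - z%:P) != 0 :> {poly K}.
Proof. by rewrite monic_neq0// monic_prod_XsubC. Qed.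

Lemma mup_prod_XsubC x r : mup x (\prod_(z <- r) ('X - z%:P)) = count_mem x r.
Proof.
elim: r => [|z r IH]; first by rewrite big_nil mupNroot// root1.
rewrite big_cons mupM ?polyXsubC_eq0 ?prod_XsubC_neq0//= IH.
by have := mup_XsubCX 1 x z; rewrite expr1 eq_sym => ->; case: eqP.
Qed.

Lemma disk_count_prod c r : c != 0 ->
  disk_count (c *: \prod_(z <- r) ('X - z%:P)) = count (fun z => `|z| < 1) r.
Proof.
move=> c0; rewrite /disk_count.
have mE x : mup x (c *: \prod_(z <- r) ('X - z%:P)) = count_mem x r.
  rewrite -mul_polyC mupMr ?mup_prod_XsubC//.
  by rewrite rootC.
rewrite -(@bigfs _ _ addn _ (undup r) [pred l : K | `|l| < 1]);
  rewrite ?undup_uniq//; last first.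
  by move=> z _; rewrite mem_undup mE => /count_memPn.
rewrite -sum1_count -[RHS]big_undup_iterop_count; apply: eq_bigr => z _.
by rewrite mE Monoid.iteropE iter_addn addn0 mul1n.
Qed.

Lemma disk_count_neq0 p : p != 0 -> exists r : seq K,
  [/\ p = lead_coef p *: \prod_(z <- r) ('X - z%:P), size p = (size r).+1,
      disk_count p = count (fun z => `|z| < 1) r & root p =i r].
Proof.
move=> p0; have [r pE] := closed_field_poly_normal p; exists r.
have lc0 : lead_coef p != 0 by rewrite lead_coef_eq0.
split=> //; rewrite {1}pE ?size_scale ?size_prod_XsubC ?disk_count_prod//.
by move=> z; rewrite -[LHS]/(root _ z) rootZ// root_prod_XsubC.
Qed.

Lemma disk_countZ c p : c != 0 -> disk_count (c *: p) = disk_count p.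
Proof.
move=> c0; have [->|p0] := eqVneq p 0; first by rewrite scaler0.
have [r [pE _ -> _]] := disk_count_neq0 p0.
by rewrite pE scalerA disk_count_prod// mulf_neq0 ?lead_coef_eq0.
Qed.

Lemma disk_countM_XsubC b p : p != 0 ->
  disk_count (('X - b%:P) * p) = ((`|b| < 1)%R + disk_count p)%N.
Proof.
move=> p0; have [r [pE _ -> _]] := disk_count_neq0 p0.
have -> : ('X - b%:P) * p = lead_coef p *: \prod_(z <- b :: r) ('X - z%:P).
  by rewrite {1}pE -scalerAr big_cons.
by rewrite disk_count_prod ?lead_coef_eq0.
Qed.

Lemma disk_count_noroot p : p != 0 -> (forall z, `|z| < 1 -> ~~ root p z) ->
  disk_count p = 0%N.
Proof.
move=> p0 nr; have [r [_ _ -> rE]] := disk_count_neq0 p0.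
apply/eqP; rewrite -leqn0 leqNgt -has_count; apply/hasPn => z zr.
by apply/negP => /nr/negP; apply; have := rE z; rewrite zr unfold_in.
Qed.

Lemma poly_horner_inj p q : (forall x, p.[x] = q.[x]) -> p = q.
Proof.
move=> pq; apply/eqP; rewrite -subr_eq0; apply/negPn/negP.
by move=> /closed_nonrootP[x]; rewrite /root hornerD hornerN pq subrr eqxx.
Qed.

(* |q y| is at most |q b| times the product over the roots z of
   |y - z| / |b - z| <= 1 + |y - b| / |b - z|. *)
Lemma near_root n p b y (e : K) : (size p <= n.+1)%N -> 0 < e ->
  `|p.[b]| * (1 + `|y - b| / e) ^+ n < `|p.[y]| ->
  exists2 z, root p z & `|z - b| < e.
Proof.
move=> sp e0 lt; have p0 : p != 0.
  by apply: contraTneq lt => ->; rewrite !horner0 normr0 mul0r ltxx.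
have [r [pE sr _ rE]] := disk_count_neq0 p0.
have [/hasP[z zr zb]|/hasPn far] := boolP (has (fun z => `|z - b| < e) r).
  by exists z => //; have := rE z; rewrite zr unfold_in.
suff : `|p.[y]| <= `|p.[b]| * (1 + `|y - b| / e) ^+ n.
  by move=> /(lt_le_trans lt); rewrite ltxx.
have c1 : 1 <= 1 + `|y - b| / e by rewrite lerDl divr_ge0// ltW.
apply: (@le_trans _ _ (`|p.[b]| * (1 + `|y - b| / e) ^+ size r)); last first.
  by rewrite ler_wpM2l// ler_weXn2l// -ltnS -sr.
rewrite pE !hornerZ !normrM -mulrA ler_wpM2l//.
rewrite !horner_prod !normr_prod.
elim: r far {pE sr rE} => [_|z r IH far]; first by rewrite !big_nil mul1r expr0.
rewrite !big_cons /= exprS mulrACA ler_pM ?normr_ge0 ?prodr_ge0//; last first.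
  by apply: IH => w wr; apply: far; rewrite inE wr orbT.
rewrite !hornerXsubC mulrDr mulr1.
have -> : y - z = (b - z) + (y - b) by rewrite [RHS]addrC subrKA.
apply: (le_trans (ler_normD _ _)); rewrite lerD2l mulrA ler_pdivlMr// mulrC.
rewrite ler_wpM2r// distrC.
by rewrite real_leNgt ?realE ?(ltW e0) ?normr_ge0//; apply: far; rewrite inE eqxx.
Qed.

(** Among finitely many roots one is nearest to [b]. Selecting it gives a choice of root independent
    of any tolerance, which [root_cvg] turns into a convergent function. *)
Lemma exists_nearest_root p b : p != 0 -> size p != 1%N ->
  exists2 z, root p z & forall w, root p w -> `|z - b| <= `|w - b|.
Proof.
move=> p0 /closed_rootP[x]; have [r [_ _ _ rE]] := disk_count_neq0 p0.
have rE' z : root p z = (z \in r) by rewrite -rE.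
rewrite rE'.
suff H : r != [::] -> exists2 z, z \in r & {in r, forall w, `|z - b| <= `|w - b|}.
  case: r rE rE' H => // a r rE rE' /(_ isT)[z zr zmin] _.
  by exists z => [|w]; rewrite rE'// => /zmin.
elim: r {rE rE'} => // a [_ _|c r /(_ isT)[z zr zmin] _].
  by exists a; rewrite ?mem_head// => w; rewrite inE => /eqP ->.
have [za|az] := real_leP (normr_real (z - b)) (normr_real (a - b)).
  exists z; first by rewrite inE zr orbT.
  by move=> w; rewrite inE => /predU1P[->//|/zmin].
exists a; first by rewrite mem_head.
move=> w; rewrite inE => /predU1P[->//|/zmin]; exact/le_trans/ltW.
Qed.

End DiskCount.

(** * Continuity of roots *)

Section PolyConvergence.
Variables (K : numClosedFieldType) (T : Type) (F : set_system T).
Context {FF : Filter F}.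

Lemma cvg_sumr (I : Type) (r : seq I) (P : pred I) (f : I -> T -> K) (g : I -> K) :
  (forall i, P i -> f i @ F --> g i) ->
  (fun t => \sum_(i <- r | P i) f i t) @ F --> \sum_(i <- r | P i) g i.
Proof. by move=> fg; apply: cvg_big => //; exact: add_continuous. Qed.

Lemma cvg_prodr (I : Type) (r : seq I) (P : pred I) (f : I -> T -> K) (g : I -> K) :
  (forall i, P i -> f i @ F --> g i) ->
  (fun t => \prod_(i <- r | P i) f i t) @ F --> \prod_(i <- r | P i) g i.
Proof. by move=> fg; apply: cvg_big => //; exact: mul_continuous. Qed.

Lemma cvg_exprn (f : T -> K) (a : K) n :
  f @ F --> a -> (fun t => f t ^+ n) @ F --> a ^+ n.
Proof.
move=> fa; elim: n => [|n IH]; first by under eq_cvg do rewrite expr0; exact: cvg_cst.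
by rewrite exprS; under eq_cvg do rewrite exprS; apply: cvgM.
Qed.

Definition coef_cvg (Q : T -> {poly K}) (P : {poly K}) :=
  forall i, (fun t => (Q t)`_i) @ F --> P`_i.

Lemma cvg_horner n Q P x : coef_cvg Q P -> (forall t, (size (Q t) <= n)%N) ->
  (size P <= n)%N -> (fun t => (Q t).[x]) @ F --> P.[x].
Proof.
move=> QP sQ sP; rewrite (horner_coef_wide _ sP).
under eq_cvg do rewrite (horner_coef_wide _ (sQ _)).
by apply: cvg_sumr => i _; apply: cvgM; [exact: QP | exact: cvg_cst].
Qed.

(** The order of [K] is partial; this converts closeness to a positive limit into positivity, for
    real quantities. *)
Lemma real_dist_gt0 (x a : K) : x \is Num.real -> `|a - x| < a -> 0 < x.
Proof.
move=> xr lt; have ar : a \is Num.real.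
  by rewrite gtr0_real// (le_lt_trans _ lt).
by move: lt; rewrite distrC real_ltr_distl ?rpredB// subrr => /andP[].
Qed.

(** Fix [y] with P(y) nonzero. Along [F] the values at [b] tend to 0 while those at [y] tend to
    P(y), so [near_root] yields roots of [Q t] as close to [b] as desired. *)
Lemma root_cvg n (Q : T -> {poly K}) (P : {poly K}) (b : K) :
  P != 0 -> (size P <= n.+1)%N ->
  (forall t, (size (Q t) <= n.+1)%N) -> coef_cvg Q P -> root P b ->
  exists2 b' : T -> K, b' @ F --> b & \forall t \near F, root (Q t) (b' t).
Proof.
move=> P0 sP sQ QP Pb.
have near_b e : 0 < e ->
    \forall t \near F, exists2 z, root (Q t) z & `|z - b| < e.
  move=> e0; have /closed_nonrootP[y Py] := P0.
  set k := (1 + `|y - b| / e) ^+ n.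
  have : (fun t => `|(Q t).[y]| - `|(Q t).[b]| * k) @ F --> `|P.[y]| - `|P.[b]| * k.
    apply: cvgB; first by apply: cvg_norm; apply: cvg_horner QP sQ sP.
    apply: cvgM; last exact: cvg_cst.
    by apply: cvg_norm; apply: cvg_horner QP sQ sP.
  rewrite (rootP Pb) normr0 mul0r subr0.
  move=> /cvgr_dist_lt/(_ `|P.[y]|); rewrite normr_gt0 => /(_ Py).
  apply: filterS => t lt; apply: (near_root (n := n) (y := y)) => //.
  rewrite -subr_gt0; apply: real_dist_gt0 lt => //.
  rewrite rpredB ?rpredM ?rpredX ?rpredD ?rpred1 ?normr_real//.
  by rewrite rpredM ?rpredV ?normr_real// gtr0_real.
(* The same nearest root serves every tolerance. When [Q t] is zero or a nonzero constant, [b]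
   itself is taken, as a nearest root in the first case and as a dummy in the second. *)
have [nearest nearestP] : {b' : T -> K & forall t, (exists z, root (Q t) z) ->
    root (Q t) (b' t) /\ forall w, root (Q t) w -> `|b' t - b| <= `|w - b|}.
  apply: (@choice _ _ (fun t z => (exists z, root (Q t) z) ->
    root (Q t) z /\ forall w, root (Q t) w -> `|z - b| <= `|w - b|)) => t.
  have [Q0|Q0] := eqVneq (Q t) 0.
    by exists b => _; rewrite Q0 root0; split=> // w _; rewrite subrr normr0.
  have [s1|s1] := eqVneq (size (Q t)) 1%N.
    by exists b => /closed_rootP; rewrite s1.
  by have [z zr zmin] := exists_nearest_root b Q0 s1; exists z.
exists nearest.
  apply/cvgrPdist_lt => e e0; apply: filterS (near_b _ e0) => t [z zr].
  apply: le_lt_trans; rewrite distrC.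
  by have [|_] := nearestP t; [exists z | apply].
apply: filterS (near_b 1 ltr01) => t [z zr _].
by have [|] := nearestP t; first by exists z.
Qed.

(** Synthetic division: the coefficient of index i of the quotient is the coefficient of index i + 1
    of the product plus the root times the coefficient of index i + 1 of the quotient. Convergence
    descends from index [n], where the quotients vanish. *)
Lemma coef_cvg_deflate n (Q Q1 : T -> {poly K}) (P1 : {poly K}) (b' : T -> K) (b : K) :
  (forall t, (size (Q1 t) <= n)%N) -> (size P1 <= n)%N ->
  coef_cvg Q (('X - b%:P) * P1) -> b' @ F --> b ->
  (\forall t \near F, Q t = ('X - (b' t)%:P) * Q1 t) -> coef_cvg Q1 P1.
Proof.
move=> sQ1 sP1 QP bb QE.
have coefE (p : {poly K}) c i : p`_i = (('X - c%:P) * p)`_i.+1 + c * p`_i.+1.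
  by rewrite mulrBl coefB coefXM coefCM /= subrK.
suff H k i : (n <= i + k)%N -> (fun t => (Q1 t)`_i) @ F --> P1`_i.
  by move=> i; apply: (H n); rewrite leq_addl.
elim: k i => [|k IH] i.
  rewrite addn0 => ni; rewrite nth_default ?(leq_trans sP1)//.
  under eq_cvg do rewrite nth_default ?(leq_trans (sQ1 _))//.
  exact: cvg_cst.
rewrite addnS -addSn => /IH cv.
have : (fun t => (Q t)`_i.+1 + b' t * (Q1 t)`_i.+1) @ F --> P1`_i.
  by rewrite (coefE P1 b); apply: cvgD; [exact: QP | exact: cvgM].
apply: cvg_trans; apply: near_eq_cvg; apply: filterS QE => t QEt.
by rewrite QEt -coefE.
Qed.

(* Hurwitz, by induction on the number of roots of P: dividing Q t by the
   linear factor of a root tending to a root of P. *)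
Lemma disk_count_cvg n (Q : T -> {poly K}) (P : {poly K}) :
  P != 0 -> (size P <= n.+1)%N ->
  (forall t, (size (Q t) <= n.+1)%N) -> coef_cvg Q P ->
  (forall z, root P z -> `|z| != 1) ->
  \forall t \near F, Q t != 0 /\ disk_count (Q t) = disk_count P.
Proof.
elim: n Q P => [|n IH] Q P P0 sP sQ QP circ.
  have [c c0 PE] : exists2 c, c != 0 & P = c%:P.
    by apply/size_poly1P; rewrite eqn_leq sP size_poly_gt0.
  have QE t : Q t = ((Q t)`_0)%:P by exact: size1_polyC.
  have : (fun t => (Q t)`_0) @ F --> c by rewrite -[c](coefC c 0) -PE; exact: QP.
  move=> /cvgr_dist_lt/(_ `|c|); rewrite normr_gt0 => /(_ c0).
  apply: filterS => t lt.
  have Q0 : Q t != 0 by apply: contraTneq lt => ->; rewrite coef0 subr0 ltxx.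
  have P_noroot z : `|z| < 1 -> ~~ root P z by rewrite PE rootC.
  have Q_noroot z : `|z| < 1 -> ~~ root (Q t) z by rewrite QE rootC -polyC_eq0 -QE.
  by rewrite !disk_count_noroot.
(* The limit may be constant while [Q t] has higher degree, its roots escaping to infinity. Then the
   constant coefficient eventually exceeds the sum of the moduli of the others, which excludes roots
   in the disk. *)
have [s1|s1] := eqVneq (size P) 1%N.
  have /size_poly1P[c c0 PE] : size P == 1%N by rewrite s1.
  have cv0 : (fun t => `|(Q t)`_0|) @ F --> `|c|.
    by apply: cvg_norm; rewrite -[c](coefC c 0) -PE; exact: QP.
  have cvS : (fun t => \sum_(i < n.+1) `|(Q t)`_i.+1|) @ F --> (0 : K).
    rewrite [X in _ --> X](_ : 0 = \sum_(i < n.+1) `|P`_i.+1|); last first.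
      by rewrite big1// => i _; rewrite PE coefC normr0.
    by apply: cvg_sumr => i _; apply: cvg_norm; exact: QP.
  have : (fun t => `|(Q t)`_0| - \sum_(i < n.+1) `|(Q t)`_i.+1|) @ F --> `|c|.
    by rewrite -[X in _ --> X]subr0; apply: cvgB.
  move=> /cvgr_dist_lt/(_ `|c|); rewrite normr_gt0 => /(_ c0); apply: filterS => t lt.
  have {}lt : \sum_(i < n.+1) `|(Q t)`_i.+1| < `|(Q t)`_0|.
    rewrite -subr_gt0; apply: real_dist_gt0 lt.
    by rewrite rpredB ?normr_real// rpred_sum// => i _; rewrite normr_real.
  have nr z : `|z| < 1 -> ~~ root (Q t) z.
    move=> z1; apply/negP => /rootP; rewrite (horner_coef_wide _ (sQ t)).
    rewrite big_ord_recl expr0 mulr1 => /eqP; rewrite addr_eq0 => /eqP Q0E.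
    suff le : `|(Q t)`_0| <= \sum_(i < n.+1) `|(Q t)`_i.+1|.
      by have := le_lt_trans le lt; rewrite ltxx.
    rewrite Q0E normrN (le_trans (ler_norm_sum _ _ _))//.
    apply: ler_sum => i _; rewrite normrM ler_piMr// normrX.
    by rewrite exprn_ile1 ?normr_ge0 ?(ltW z1).
  have Q0 : Q t != 0.
    apply: contraTneq lt => ->; rewrite coef0 normr0 lt_neqAle negb_and orbC.
    suff -> : \sum_(i < n.+1) `|(0 : {poly K})`_i.+1| = 0 :> K by rewrite eqxx orbT.
    by rewrite big1// => i _; rewrite coef0 normr0.
  have P_noroot z : `|z| < 1 -> ~~ root P z by rewrite PE rootC.
  by rewrite !disk_count_noroot.
have /closed_rootP[b Pb] := s1.
have [b' b'b b'r] := root_cvg P0 sP sQ QP Pb.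
have /factor_theorem[P1] := Pb; rewrite mulrC => PE.
have P10 : P1 != 0 by apply: contraNneq P0 => P10; rewrite PE P10 mulr0.
pose Q1 t := Q t %/ ('X - (b' t)%:P).
have QE : \forall t \near F, Q t = ('X - (b' t)%:P) * Q1 t.
  by apply: filterS b'r => t; rewrite root_factor_theorem => /divpK; rewrite mulrC.
have sQ1 t : (size (Q1 t) <= n.+1)%N.
  by rewrite size_divp ?polyXsubC_eq0// size_XsubC leq_subLR add1n.
have sP1 : (size P1 <= n.+1)%N.
  by move: sP; rewrite PE size_mul ?polyXsubC_eq0// size_XsubC.
have Q1P1 : coef_cvg Q1 P1 by apply: coef_cvg_deflate sQ1 sP1 _ b'b QE; rewrite -PE.
have circ1 z : root P1 z -> `|z| != 1.
  by move=> zr; apply: circ; rewrite PE rootM zr orbT.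
have b1 := circ _ Pb.
have : \forall t \near F, (`|b' t| < 1) = (`|b| < 1).
  have cvb : (fun t => `|b' t|) @ F --> `|b| by exact: cvg_norm.
  move: cvb => /cvgr_dist_lt/(_ `| `|b| - 1|).
  rewrite normr_gt0 subr_eq0 => /(_ b1); apply: filterS => t.
  have [blt1|bge1] := real_ltP (normr_real b) (real1 K).
    rewrite distrC real_ltr_distl ?rpredB ?normr_real// => /andP[_].
    by rewrite addrC subrK.
  rewrite distrC real_ltr_distl ?rpredB ?normr_real// => /andP[+ _].
  rewrite opprB addrC subrK => /ltW.
  by rewrite real_leNgt ?real1 ?normr_real// => /negbTE.
move=> near_b.
apply: filterS3 QE near_b (IH _ _ P10 sP1 sQ1 Q1P1 circ1) => t QEt bE [Q10 cE].
by rewrite QEt PE !disk_countM_XsubC// bE cE mulf_neq0 ?polyXsubC_eq0.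
Qed.

End PolyConvergence.

(** * Polynomials in several variables *)

Section PolyConvergence.
Variables (K : numClosedFieldType) (T : Type) (F : set_system T).
Context {FF : Filter F}.

Lemma cvg_meval m (G : mpoly m K) (h : 'I_m -> T -> K) (g : 'I_m -> K) :
  (forall i, h i @ F --> g i) ->
  (fun t => meval (h^~ t) G) @ F --> meval g G.
Proof.
move=> hg; rewrite mevalE; under eq_cvg do rewrite mevalE.
apply: cvg_sumr => d _; apply: cvgM; first exact: cvg_cst.
by apply: cvg_prodr => i _; apply: cvg_exprn.
Qed.

Lemma coef_cvgM (p q : T -> {poly K}) (p0 q0 : {poly K}) :
  coef_cvg F p p0 -> coef_cvg F q q0 -> coef_cvg F (fun t => p t * q t) (p0 * q0).
Proof.
move=> pp qq i; rewrite coefM; under eq_cvg do rewrite coefM.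
by apply: cvg_sumr => j _; apply: cvgM; [exact: pp | exact: qq].
Qed.

Lemma coef_cvg_cst (p : {poly K}) : coef_cvg F (fun=> p) p.
Proof. by move=> i; exact: cvg_cst. Qed.

Lemma coef_cvg_prod (I : Type) (r : seq I) (p : I -> T -> {poly K})
    (q : I -> {poly K}) : (forall i, coef_cvg F (p i) (q i)) ->
  coef_cvg F (fun t => \prod_(i <- r) p i t) (\prod_(i <- r) q i).
Proof.
move=> pq; elim: r => [|a r IH] i.
  by rewrite big_nil; under eq_cvg do rewrite big_nil; exact: coef_cvg_cst.
rewrite big_cons; under eq_cvg do rewrite big_cons.
exact: (coef_cvgM (pq a) IH).
Qed.

Lemma coef_cvg_mmap m (G : mpoly m K) (h : 'I_m -> T -> {poly K})
    (g : 'I_m -> {poly K}) : (forall i, coef_cvg F (h i) (g i)) ->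
  coef_cvg F (fun t => mmap polyC (h^~ t) G) (mmap polyC g G).
Proof.
move=> hg i; rewrite /mmap coef_sum; under eq_cvg do rewrite coef_sum.
apply: cvg_sumr => d _; apply: coef_cvgM => {i}; first exact: coef_cvg_cst.
apply: coef_cvg_prod => k; elim: (d k) => [|e IH] i.
  by rewrite expr0; under eq_cvg do rewrite expr0; exact: coef_cvg_cst.
rewrite exprS; under eq_cvg do rewrite exprS.
exact: (coef_cvgM (hg k) IH).
Qed.

End PolyConvergence.

Section MPolyEval.
Variable K : numClosedFieldType.

Lemma horner_mmap m (G : mpoly m K) (h : 'I_m -> {poly K}) (x : K) :
  (mmap polyC h G).[x] = meval (fun i => (h i).[x]) G.
Proof.
rewrite /meval /mmap horner_sum; apply: eq_bigr => d _.
rewrite hornerM hornerC /mmap1 horner_prod; congr (_ * _).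
by apply: eq_bigr => i _; rewrite horner_exp.
Qed.

Lemma size_mmap m (G : mpoly m K) (h : 'I_m -> {poly K}) :
  (forall i, (size (h i) <= 2)%N) -> (size (mmap polyC h G) <= mmeasure mdeg G)%N.
Proof.
move=> sh; apply: (leq_trans (size_sum _ _ _)).
apply/bigmax_leqP_seq => d dG _; apply: leq_trans (msize_mdeg_lt dG).
have sM (a b : nat) (p q : {poly K}) : (size p <= a.+1)%N -> (size q <= b.+1)%N ->
    (size (p * q)%R <= (a + b).+1)%N.
  move=> sp sq; apply: (leq_trans (size_polyMleq _ _)).
  by rewrite -subn1 leq_subLR (leq_trans (leq_add sp sq))// addnS addSn add1n.
rewrite -[mdeg d]add0n; apply: (sM); first by rewrite size_polyC leq_b1.
rewrite mdegE /mmap1.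
  apply: (big_ind2 (fun (p : {poly K}) (a : nat) => (size p <= a.+1)%N)).
- by rewrite size_poly1.
- by move=> p a q b; exact: sM.
move=> i _; elim: (d i) => [|k IH]; first by rewrite size_poly1.
by rewrite exprS; exact: (sM 1%N k _ _ (sh i) IH).
Qed.

(** Uniqueness of base [B] expansions: reduction modulo [B] gives the lowest digit, and cancelling
    it leaves a shorter expansion. It keeps distinct monomials distinct under the Kronecker
    substitution. *)
Lemma digits_inj B m (a b : 'I_m -> nat) :
  (forall i, (a i < B)%N) -> (forall i, (b i < B)%N) ->
  (\sum_i a i * B ^ i = \sum_i b i * B ^ i)%N -> a =1 b.
Proof.
elim: m a b => [|m IH] a b aB bB; first by move=> _ [].
have B0 : (0 < B)%N by exact: leq_ltn_trans (aB ord0).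
have tailE (c : 'I_m.+1 -> nat) : (\sum_i c i * B ^ i =
    (\sum_(i < m) c (lift ord0 i) * B ^ i) * B + c ord0)%N.
  rewrite big_ord_recl muln1 addnC; congr addn.
  by rewrite big_distrl/=; apply: eq_bigr => i _; rewrite -mulnA -expnSr.
rewrite !tailE => eq_sum.
have e0 : a ord0 = b ord0.
  have := congr1 (modn^~ B) eq_sum.
  by rewrite /= !modnMDl !modn_small.
move: eq_sum; rewrite e0 => /addIn/eqP; rewrite eqn_pmul2r// => /eqP/IH e.
move=> i; case: (unliftP ord0 i) => [j ->|-> //].
by apply: (e _ _ j) => k; [exact: aB | exact: bB].
Qed.

(* Kronecker substitution: X_i := X ^ (B ^ i) with B larger than the degree. *)
Lemma mpoly_neq0_meval m (G : mpoly m K) : G != 0 -> exists v, meval v G != 0.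
Proof.
move=> G0; set B := mmeasure mdeg G.
have GB d : d \in msupp G -> forall i, (d i < B)%N.
  move=> dG i; apply: leq_ltn_trans (msize_mdeg_lt dG).
  by rewrite mdegE (bigD1 i)//= leq_addr.
pose p := mmap polyC (fun i : 'I_m => 'X^(B ^ i)) G.
suff /closed_nonrootP[x] : p != 0.
  by rewrite /root horner_mmap; exists (fun i => ('X^(B ^ i) : {poly K}).[x]).
have [d0 d0G] : exists d0, d0 \in msupp G.
  by exists (mlead G); rewrite mlead_supp.
pose key (d : multinom m) := (\sum_(i < m) d i * B ^ i)%N.
have pE : p = \sum_(d <- msupp G) mcoeff d G *: 'X^(key d).
  rewrite /p /mmap; apply: eq_bigr => d _; rewrite mul_polyC /mmap1; congr (_ *: _).
  rewrite /key (big_morph _ (exprD 'X) (expr0 'X)); apply: eq_bigr => i _.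
  by rewrite -exprM mulnC.
apply/eqP => /(congr1 (fun q : {poly K} => q`_(key d0))).
rewrite coef0 pE coef_sum (bigD1_seq d0) ?msupp_uniq//= big1_seq ?addr0.
  by rewrite coefZ coefXn eqxx mulr1 => /eqP; apply/negP; rewrite -mcoeff_msupp.
move=> d /andP[dd0 dG]; rewrite coefZ coefXn.
case: eqP => [/(digits_inj (GB _ d0G) (GB _ dG)) e|]; last by rewrite mulr0.
by case/eqP: dd0; apply/mnmP => i; rewrite e.
Qed.

(** Congruence modulo [l] is compatible with sums and products, so variables may be replaced by
    congruent polynomials. *)
Lemma mpoly_eq_mod_linear m (G : mpoly m K) (h : 'I_m -> mpoly m K) (l : mpoly m K) :
  (forall i, exists H, mpolyX K (mnm1 i) = h i + l * H) ->
  exists H, G = mmap (@mpolyC m K) h G + l * H.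
Proof.
move=> hX; pose E (a b : mpoly m K) := exists H, a = b + l * H.
have E0 a : E a a by exists 0; rewrite mulr0 addr0.
have ED a b c d : E a b -> E c d -> E (a + c) (b + d).
  by move=> [H ->] [H' ->]; exists (H + H'); rewrite mulrDr addrACA.
have EM a b c d : E a b -> E c d -> E (a * c) (b * d).
  move=> [H ->] [H' ->]; exists (b * H' + H * d + H * (l * H')).
  rewrite mulrDl !mulrDr -!addrA; congr (_ + _).
  by rewrite !mulrA (mulrC l b) -!mulrA.
rewrite {1}[G]mpolyE /mmap; apply: (big_ind2 E) => // d _.
rewrite -mul_mpolyC; apply: (EM) => //; rewrite -mmap1_id /mmap1.
elim: (index_enum _) => [|i r IH]; first by rewrite !big_nil.
rewrite !big_cons; apply: (EM) => //.
elim: (d i) => [|k IHk]; first by rewrite !expr0.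
by rewrite !exprS; apply: (EM).
Qed.

(** Substituting [s *: X i] for [X j] turns [G] into a polynomial with only zero values, hence into
    0, so [X j - s *: X i] divides [G]. This linear form vanishes at 0 and is not a unit, so the
    cofactor is one and has no zeros. *)
Lemma irreducible_linear m (G : mpoly m K) (i j : 'I_m) (s : K) : i != j ->
  irreducible_elt G -> (forall v, v j = s * v i -> meval v G = 0) ->
  forall v, meval v G = 0 <-> v j = s * v i.
Proof.
move=> ij [_ _ irr] van v; split; last exact: van.
pose X k : mpoly m K := mpolyX K (mnm1 k).
pose h k := if k == j then s *: X i else X k.
have [|H GE] := @mpoly_eq_mod_linear m G h (X j - s *: X i).
  move=> k; rewrite /h; case: eqP => [->|_]; last by exists 0; rewrite mulr0 addr0.
  by exists 1; rewrite mulr1 addrC subrK.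
have hG0 : mmap (@mpolyC m K) h G = 0.
  apply/eqP/negPn/negP => /mpoly_neq0_meval[w]; apply/negP/negPn/eqP.
  have -> : meval w (mmap (@mpolyC m K) h G) = meval (fun k => meval w (h k)) G.
    rewrite /mmap rmorph_sum/= mevalE; apply: eq_bigr => d _.
    rewrite mevalM mevalC /mmap1 rmorph_prod; congr (_ * _).
    by apply: eq_bigr => k _; rewrite rmorphXn.
  apply: van; rewrite /h eqxx (negbTE ij) mevalZ.
  by rewrite !mevalXU.
rewrite hG0 add0r in GE.
have unit_meval (u : mpoly m K) w : u \is a GRing.unit -> meval w u != 0.
  by move=> uu; rewrite -unitfE; apply: (rmorph_unit (meval w)).
have evl w : meval w (X j - s *: X i) = w j - s * w i.
  by rewrite mevalB mevalZ !mevalXU.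
case: (irr _ _ GE) => [/(unit_meval _ (fun=> 0))|/(unit_meval _ v) Hv].
  by rewrite evl mulr0 subrr eqxx.
rewrite GE mevalM evl => /eqP; rewrite mulf_eq0 (negbTE Hv) orbF subr_eq0.
by move/eqP.
Qed.

(** Shift [x] and [y] by a small nonzero t in direction [i] and restrict [G] to the line joining
    them, on which coordinate [i] is constantly t. The restriction is small at 0 and close to G(y)
    at 1, so [near_root] places a root near 0. *)
Lemma near_zero_off_hyperplane m (G : mpoly m K) (x y : 'I_m -> K) i (e : K) :
  x i = 0 -> y i = 0 -> meval x G = 0 -> meval y G != 0 -> 0 < e ->
  exists z, [/\ forall k, `|z k - x k| < e, z i != 0 & meval z G = 0].
Proof.
move=> xi yi Gx Gy e0.
(* The budget [e] is split in two: a root of modulus below [r] moves each coordinate by at most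
   [M * r = e / 2], and the shift by t uses the other half. [k] is the factor in [near_root] for the
   points 0 and 1 and the radius [r]. *)
set M := 1 + \sum_k `|y k - x k|.
have M0 : 0 < M by rewrite ltr_pwDl// sumr_ge0.
set r := e / 2 / M; have r0 : 0 < r by rewrite !divr_gt0.
set N := mmeasure mdeg G; set k := (1 + `|1 - 0| / r) ^+ N.
pose shift (w : 'I_m -> K) j (t : K) := w j + (j == i)%:R * t.
have cv w : (fun t => meval ((shift w)^~ t) G) @ 0^' --> meval w G.
  apply: cvg_meval => j.
  rewrite -[X in _ --> X]addr0 -[X in _ --> _ + X](mulr0 (j == i)%:R).
  apply: cvgD; first exact: cvg_cst.
  apply: cvgM; first exact: cvg_cst.
  exact: nbhs_dnbhs.
have : (fun t => `|meval ((shift y)^~ t) G| - `|meval ((shift x)^~ t) G| * k)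
    @ 0^' --> `|meval y G|.
  rewrite -[X in _ --> X]subr0 -[X in _ --> _ - X](mul0r k).
  apply: cvgB; first by apply: cvg_norm; exact: cv.
  apply: cvgM; last exact: cvg_cst.
  rewrite [X in _ --> X](_ : 0 = `|meval x G|); last by rewrite Gx normr0.
  by apply: cvg_norm; exact: cv.
move=> /cvgr_dist_lt/(_ `|meval y G|); rewrite normr_gt0 => /(_ Gy) near1.
have near2 : \forall t \near (0 : K)^', `|t| < e / 2.
  by apply: dnbhs0_lt; rewrite divr_gt0.
have near3 : \forall t \near (0 : K)^', t != 0 by exact: nbhs_dnbhs_neq.
have FF : ProperFilter ((0 : K)^') by exact: Proper_dnbhs_numFieldType.
have [t [[lt te] t0]] := filter_ex (filterI (filterI near1 near2) near3).
pose h j : {poly K} := (shift x j t)%:P + (y j - x j) *: 'X.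
have hE j c : (h j).[c] = shift x j t + (y j - x j) * c by rewrite !hornerE.
have [|||z zr zr0] := @near_root K N (mmap polyC h G) 0 1 r.
- apply: (leq_trans (size_mmap _ _)) => // j.
  apply: (leq_trans (size_polyD _ _)); rewrite geq_max.
  rewrite (leq_trans (size_polyC_leq1 _))//.
  by rewrite (leq_trans (size_scale_leq _ _))// size_polyX.
- by [].
- rewrite !horner_mmap -subr_gt0.
  rewrite (meval_eq _ (v1 := fun i => (h i).[0]) (v2 := (shift x)^~ t)); last first.
    by move=> j; rewrite hE mulr0 addr0.
  rewrite (meval_eq _ (v1 := fun i => (h i).[1]) (v2 := (shift y)^~ t)); last first.
    by move=> j; rewrite hE mulr1 /shift addrAC (addrC (x j)) subrK.
  apply: real_dist_gt0 lt.
  rewrite rpredB ?rpredM ?rpredX ?rpredD ?rpred1 ?normr_real//.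
  by rewrite rpredM ?rpredV ?normr_real// gtr0_real.
exists (fun j => (h j).[z]); split.
- move=> j; rewrite hE.
  have -> : shift x j t + (y j - x j) * z - x j =
    (j == i)%:R * t + (y j - x j) * z by rewrite /shift; ring.
  have lt2 : `|(j == i)%:R * t| < e / 2.
    by case: eqP => _; rewrite ?mul1r// mul0r normr0 divr_gt0.
  have le2 : `|(y j - x j) * z| <= e / 2.
    rewrite normrM; apply: (@le_trans _ _ (M * r)); last by rewrite mulrC divfK ?gt_eqF.
    apply: ler_pM => //; last by move: zr0; rewrite subr0 => /ltW.
    by rewrite /M (bigD1 j)//= addrCA lerDl addr_ge0// sumr_ge0.
  rewrite (le_lt_trans (ler_normD _ _))// [e](splitr e) ltr_leD//.
- by rewrite hE /shift xi yi eqxx subrr mul0r !add0r addr0 mul1r.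
- by rewrite -horner_mmap; apply/rootP.
Qed.

(** * Homogeneous polynomials and homogenization *)

Lemma meval_homog m (G : mpoly m K) d c v : G \is ishomog1 d mdeg ->
  meval (fun i => c * v i) G = c ^+ d * meval v G.
Proof.
move=> /dhomogP hG; rewrite !mevalE big_distrr/=; apply: eq_big_seq => a aG.
rewrite mulrCA; congr (_ * _); have <- : mdeg a = d by exact: hG.
rewrite mdegE -prodrXr -big_split/=.
by apply: eq_bigr => i _; rewrite exprMn.
Qed.


Lemma mdeg_pair (d : multinom 2) : mdeg d = (d ord0 + d ord_max)%N.
Proof.
rewrite mdegE !big_ord_recl big_ord0 addn0; congr (_ + d _)%N; exact/val_inj.
Qed.

Lemma mdeg_triple (a b c : nat) : mdeg (Multinom [tuple a; b; c]) = (a + b + c)%N.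
Proof.
by rewrite mdegE !big_ord_recl big_ord0 !multinomE !(tnth_nth 0%N)/= addn0 addnA.
Qed.

(** The subtraction is truncated; this is the homogenization in degree [n] once [n] bounds the
    degree of [f], that is, [mmeasure mdeg f <= n.+1], since [mmeasure mdeg] is the degree plus one
    for nonzero polynomials. *)
Definition homogenize n (f : mpoly 2 K) : mpoly 3 K :=
  \sum_(d <- msupp f) mcoeff d f *:
    mpolyX K (Multinom [tuple d ord0; d ord_max; (n - mdeg d)%N]).

Lemma meval_homogenize n f (v : 'I_3 -> K) : meval v (homogenize n f) =
  \sum_(d <- msupp f)
    mcoeff d f * (v 0 ^+ d ord0 * v 1 ^+ d ord_max * v ord_max ^+ (n - mdeg d)).
Proof.
rewrite /homogenize rmorph_sum/=; apply: eq_bigr => d _.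
rewrite mevalZ mevalX !big_ord_recl big_ord0 mulr1 mulrA /=.
congr (_ * (_ ^+ _ * _ ^+ _ * _ ^+ _)).
all: by rewrite ?multinomE ?(tnth_nth 0%N)//=; congr v; apply/val_inj.
Qed.

Lemma homogenize_deg n f : (mmeasure mdeg f <= n.+1)%N ->
  (mmeasure mdeg (homogenize n f) <= n.+1)%N.
Proof.
move=> sf; apply: (leq_trans (mmeasure_sum _ _ _ _)).
apply/bigmax_leqP_seq => d df _; apply: (leq_trans (mmeasureZ_le _ _ _)).
have dn : (mdeg d <= n)%N by rewrite -ltnS (leq_trans (msize_mdeg_lt df)).
rewrite mmeasureX ltnS -[X in (X <= _)%N]/(mdeg _) mdeg_triple.
by rewrite -mdeg_pair subnKC.
Qed.

Lemma meval_homogenize_unit n f (v : 'I_3 -> K) (w : 'I_2 -> K) :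
  (mmeasure mdeg f <= n.+1)%N -> v 0 = v ord_max * w ord0 ->
  v 1 = v ord_max * w ord_max ->
  meval v (homogenize n f) = v ord_max ^+ n * meval w f.
Proof.
move=> sf v0 v1; rewrite meval_homogenize mevalE big_distrr/=.
apply: eq_big_seq => d df; rewrite v0 v1 [RHS]mulrCA; congr (_ * _).
have dn : (mdeg d <= n)%N by rewrite -ltnS (leq_trans (msize_mdeg_lt df)).
rewrite -{2}(subnKC dn) exprD mdegE !exprMn !big_ord_recl !big_ord0 mulr1 addn0 exprD.
rewrite (_ : lift ord0 ord0 = ord_max :> 'I_2); last exact/val_inj.
by ring.
Qed.

(** Where the last coordinate is 0, the factor [0 ^+ (n - mdeg d)] keeps exactly the terms of degree
    [n]. This top degree part contains the leading monomial of [f], so it is a nonzero polynomial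
    and has a nonzero value. *)
Lemma homogenize_infinity n f : mmeasure mdeg f = n.+1 ->
  exists2 v : 'I_3 -> K, v ord_max = 0 & meval v (homogenize n f) != 0.
Proof.
move=> sf; have f0 : f != 0 by rewrite -(mmeasure_poly_eq0 mdeg) sf.
have top : mdeg (mlead f) = n by apply/eqP; rewrite -eqSS mlead_deg// sf.
have : pihomog mdeg n f != 0.
  apply/eqP => /(congr1 (mcoeff (mlead f))); apply/eqP.
  rewrite mcoeff0 pihomogE raddf_sum/= big_mkcond/=.
  rewrite (bigD1_seq (mlead f)) ?mlead_supp ?msupp_uniq//= top eqxx big1 ?addr0.
    by rewrite mcoeffZ mcoeffX eqxx mulr1 -mcoeff_msupp mlead_supp.
  move=> d dl; case: ifP => // _.
  by rewrite mcoeffZ mcoeffX (negbTE dl) mulr0.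
move=> /mpoly_neq0_meval[w fw].
exists (fun i =>
  if i == ord_max then 0 else if i == 0 then w ord0 else w ord_max) => //.
apply: contra_neq fw => H; rewrite -[RHS]H.
rewrite meval_homogenize pihomogE rmorph_sum/=.
rewrite big_mkcond; apply: eq_big_seq => d df.
have dn : (mdeg d <= n)%N by rewrite -ltnS -sf (msize_mdeg_lt df).
rewrite mevalZ mevalX expr0n subn_eq0.
rewrite eqn_leq dn /=; case: leqP => _; last by rewrite mulr0 mulr0.
rewrite mulr1 !big_ord_recl big_ord0 mulr1.
by rewrite (_ : lift ord0 ord0 = ord_max :> 'I_2); last exact/val_inj.
Qed.

End MPolyEval.

(** * The map alpha in homogeneous coordinates *)

Section ComplexConvergence.
Variables (R : realType) (T : Type) (F : set_system T).
Context {FF : Filter F}.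
Local Notation C := [the numClosedFieldType of R[i]].

Lemma norm_real_complex (x : R) : `|real_complex R x| = real_complex R `|x| :> C.
Proof. by rewrite normc_def /= expr0n addr0 sqrtr_sqr. Qed.

Lemma cvg_real_complex (f : T -> R) (a : R) :
  f @ F --> a -> (fun t => real_complex R (f t) : C) @ F --> (real_complex R a : C).
Proof.
move=> fa; apply/cvgrPdist_lt => e e0.
have er : e = real_complex R (complex.Re e) by rewrite RRe_real ?gtr0_real.
move: e0; rewrite er ltcR => e0; move/cvgrPdist_lt: fa => /(_ _ e0).
apply: filterS => t; rewrite -rmorphB/= norm_real_complex ltcR//.
Qed.

Lemma cvg_complex (f g : T -> R) (a b : R) : f @ F --> a -> g @ F --> b ->
  (fun t => Complex (f t) (g t) : C) @ F --> (Complex a b : C).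
Proof.
move=> /cvg_real_complex fa /cvg_real_complex gb.
have -> : (fun t => Complex (f t) (g t) : C) =
    (fun t => (real_complex R (f t) : C) +
              (Complex 0 1 : C) * (real_complex R (g t) : C)).
  by apply/funext => t; exact: (complexE (Complex (f t) (g t))).
rewrite (complexE (Complex a b)) /=.
have ib : (fun t => (Complex 0 1 : C) * (real_complex R (g t) : C)) @ F -->
    ((Complex 0 1 : C) * (real_complex R b : C)).
  by apply: cvgM; [exact: cvg_cst | exact: gb].
exact: (cvgD fa ib).
Qed.

Lemma cvg_Re (f : T -> C) (a : C) :
  f @ F --> a -> (fun t => complex.Re (f t)) @ F --> complex.Re a.
Proof.
move=> fa; apply/cvgrPdist_lt => e e0.
have e0' : 0 < real_complex R e by rewrite ltcR.
move/cvgrPdist_lt: fa => /(_ _ e0'); apply: filterS => t.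
rewrite normc_def => lt; rewrite -ltcR; apply: le_lt_trans lt.
rewrite lecR; case: a (f t) => [x y] [x' y'] /=.
by rewrite -sqrtr_sqr ler_wsqrtr// lerDl sqr_ge0.
Qed.

Lemma cvg_Im (f : T -> C) (a : C) :
  f @ F --> a -> (fun t => complex.Im (f t)) @ F --> complex.Im a.
Proof.
move=> fa; apply/cvgrPdist_lt => e e0.
have e0' : 0 < real_complex R e by rewrite ltcR.
move/cvgrPdist_lt: fa => /(_ _ e0'); apply: filterS => t.
rewrite normc_def => lt; rewrite -ltcR; apply: le_lt_trans lt.
rewrite lecR; case: a (f t) => [x y] [x' y'] /=.
by rewrite -sqrtr_sqr ler_wsqrtr// lerDr sqr_ge0.
Qed.

End ComplexConvergence.

Section Main.
Variable R : realType.
Local Notation C := [the numClosedFieldType of R[i]].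
Local Notation R3 := (R * R * R)%type.
Local Notation cbar z := (conjc z : C).
Local Notation "x %:C" := (real_complex R x).

(** Points are taken as functions on ['I_3], the form that [meval] expects. *)
Definition alphaf (w : 'I_3 -> C) : R3 := alpha_hom (\row_i w i).

Definition vec3 (K : Type) (u v w : K) : 'I_3 -> K := tnth [tuple u; v; w].

Lemma alphafE (w : 'I_3 -> C) : alphaf w =
  R3_of (`|w 0| ^+ 2 / (`|w 0| ^+ 2 + `|w 1| ^+ 2 + `|w ord_max| ^+ 2))
    (cbar (w 0) * w 1 / (`|w 0| ^+ 2 + `|w 1| ^+ 2 + `|w ord_max| ^+ 2)).
Proof. by rewrite /alphaf /alpha_hom !mxE. Qed.

Lemma alphaf_scale (c : C) (w w' : 'I_3 -> C) : c != 0 ->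
  (forall i, w' i = c * w i) -> alphaf w' = alphaf w.
Proof.
move=> c0 ww; rewrite /alphaf -[RHS](alpha_hom_scale _ c0); congr alpha_hom.
by apply/rowP => i; rewrite !mxE.
Qed.

Lemma cvg_conjc (T : Type) (F : set_system T) {FF : Filter F} (f : T -> C) (a : C) :
  f @ F --> (a) ->
  (fun t => cbar (f t)) @ F --> (cbar a).
Proof.
move=> fa; apply/cvgrPdist_lt => e e0; move/cvgrPdist_lt: fa => /(_ _ e0).
apply: filterS => t; rewrite -rmorphB/= !normc_def.
by case: (a - f t) => x y /=; rewrite sqrrN.
Qed.

Lemma cvg_alphaf (T : Type) (F : set_system T) {FF : Filter F}
    (h : 'I_3 -> T -> C) (w : 'I_3 -> C) : (exists i, w i != 0) ->
  (forall i, h i @ F --> (w i)) ->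
  (fun t => alphaf (h^~ t)) @ F --> alphaf w.
Proof.
move=> w0 hw; rewrite alphafE; under eq_cvg do rewrite alphafE.
have nw i : (fun t => `|h i t| ^+ 2) @ F --> (`|w i| ^+ 2).
  by apply: cvg_exprn; apply: cvg_norm.
have s0 : `|w 0| ^+ 2 + `|w 1| ^+ 2 + `|w ord_max| ^+ 2 != 0.
  have sq_ge0 (z : C) : 0 <= `|z| ^+ 2 by rewrite exprn_ge0.
  rewrite !paddr_eq0 ?addr_ge0// !sqrf_eq0 !normr_eq0; case: w0 => i.
  apply: contra => /andP[/andP[/eqP w0 /eqP w1] /eqP w2].
  case: i => [[|[|[|//]]] i3]; apply/eqP;
    [rewrite -[RHS]w0|rewrite -[RHS]w1|rewrite -[RHS]w2]; congr w; exact/val_inj.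
have sV : (fun t => (`|h 0 t| ^+ 2 + `|h 1 t| ^+ 2 + `|h ord_max t| ^+ 2)^-1) @ F -->
    ((`|w 0| ^+ 2 + `|w 1| ^+ 2 + `|w ord_max| ^+ 2)^-1).
  by apply: cvgV => //; apply: cvgD => //; apply: cvgD.
have cvn : (fun t => cbar (h 0 t) * h 1 t) @ F --> cbar (w 0) * w 1.
  exact: (cvgM (cvg_conjc (hw 0)) (hw 1)).
have cvc : (fun t => cbar (h 0 t) * h 1 t /
      (`|h 0 t| ^+ 2 + `|h 1 t| ^+ 2 + `|h ord_max t| ^+ 2)) @ F -->
    (cbar (w 0) * w 1 / (`|w 0| ^+ 2 + `|w 1| ^+ 2 + `|w ord_max| ^+ 2)).
  exact: (cvgM cvn sV).
have cva : (fun t => `|h 0 t| ^+ 2 /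
      (`|h 0 t| ^+ 2 + `|h 1 t| ^+ 2 + `|h ord_max t| ^+ 2)) @ F -->
    (`|w 0| ^+ 2 / (`|w 0| ^+ 2 + `|w 1| ^+ 2 + `|w ord_max| ^+ 2)).
  exact: (cvgM (nw 0) sV).
exact: (cvg_pair (cvg_pair (cvg_Re cva) (cvg_Re cvc)) (cvg_Im cvc)).
Qed.

Lemma ord3_ind (P : 'I_3 -> Prop) : P 0 -> P 1 -> P ord_max -> forall i, P i.
Proof.
move=> P0 P1 P2 [[|[|[|k]]] i3].
- by have -> : Ordinal i3 = 0 by exact/val_inj.
- by have -> : Ordinal i3 = 1 by exact/val_inj.
- by have -> : Ordinal i3 = ord_max by exact/val_inj.
- by exfalso; move: i3.
Qed.

Lemma near_C3 (w : 'I_3 -> C) (P : set (C * C * C)) :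
  nbhs ((w 0), (w 1), (w ord_max)) P ->
  exists2 e : C, 0 < e & forall w' : 'I_3 -> C,
    (forall i, `|w' i - w i| < e) -> P (w' 0, w' 1, w' ord_max).
Proof.
move=> /nbhs_ballP[e e0 sub]; exists e => // w' ww.
by apply: sub; split; [split|]; rewrite /ball/= distrC; exact: ww.
Qed.

Lemma proj_C3 (w : 'I_3 -> C) i :
  (fun t : C * C * C => vec3 t.1.1 t.1.2 t.2 i) @
    nbhs ((w 0), (w 1), (w ord_max))
  --> (w i).
Proof.
have cv (U : topologicalType) (a b c : U) :
    [/\ (fun t : U * U * U => t.1.1) @ nbhs (a, b, c) --> a,
        (fun t : U * U * U => t.1.2) @ nbhs (a, b, c) --> b &
        (fun t : U * U * U => t.2) @ nbhs (a, b, c) --> c].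
  split; [|  |exact: cvg_snd].
    exact: (cvg_comp _ _ cvg_fst cvg_fst).
  exact: (cvg_comp _ _ cvg_fst cvg_snd).
have [c0 c1 c2] := cv _ (w 0) (w 1) (w ord_max).
by elim/ord3_ind: i; [exact: c0 | exact: c1 | exact: c2].
Qed.

Lemma vec3_eta (K : Type) (w : 'I_3 -> K) : vec3 (w 0) (w 1) (w ord_max) =1 w.
Proof. by elim/ord3_ind; rewrite /vec3 (tnth_nth (w 0)). Qed.

(** The complement of [A] is open and [alphaf] is continuous at a nonzero [w], so failure at [w]
    would spread to all points near [w]. *)
Lemma closed_alphaf (A : set R3) (w : 'I_3 -> C) : closed A ->
  (exists i, w i != 0) ->
  (forall e : C, 0 < e -> exists2 w' : 'I_3 -> C,
     forall i, `|w' i - w i| < e & A (alphaf w')) ->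
  A (alphaf w).
Proof.
move=> cA w0 lim; apply: contrapT => nA.
have oA : open (~` A) by rewrite openC.
have := cvg_alphaf (FF := nbhs_filter _) w0 (@proj_C3 w).
move=> /(_ _ (open_nbhs_nbhs (conj oA nA)))/near_C3[e e0 H].
have [w' /H + Aw'] := lim _ e0.
rewrite /= (_ : vec3 _ _ _ = w')//; apply/funext; exact: vec3_eta.
Qed.

Lemma meval_closed (G : mpoly 3 C) (w : 'I_3 -> C) :
  (forall e : C, 0 < e -> exists2 w' : 'I_3 -> C,
     forall i, `|w' i - w i| < e & meval w' G = 0) ->
  meval w G = 0.
Proof.
move=> lim; apply/eqP/negPn/negP => Gw.
have := cvg_meval (FF := nbhs_filter _) (G := G) (@proj_C3 w).
move=> /cvgrPdist_lt/(_ `|meval w G|); rewrite normr_gt0 => /(_ Gw)/near_C3[e e0 H].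
have [w' /H + Gw'] := lim _ e0.
by rewrite /= (meval_eq _ (vec3_eta w')) Gw' subr0 ltxx.
Qed.

End Main.

(** * Behaviour of N_f *)

Section DiskScale.
Variable K : numClosedFieldType.

(** The root on the circle is one of at most [n] roots and is not counted. *)
Lemma disk_count_lt (p : {poly K}) (z : K) n : p != 0 -> (size p <= n.+1)%N ->
  root p z -> `|z| = 1 -> (disk_count p < n)%N.
Proof.
move=> p0 sp pz z1; have [r [_ sr -> rE]] := disk_count_neq0 p0.
have zr : z \in r by rewrite -rE.
rewrite sr ltnS in sp; apply: leq_trans sp.
rewrite -(count_predC (fun z => `|z| < 1) r) -addn1 leq_add2l -has_count.
by apply/hasP; exists z => //=; rewrite z1 ltxx.
Qed.

(** The roots of p(cX) are the x / c for x a root of p. Those in the unit disk come from |x| < c,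
    which covers the roots counted before and also [z]. *)
Lemma disk_count_scale (p : {poly K}) (c z : K) : p != 0 -> 1 < c ->
  root p z -> `|z| = 1 -> (disk_count p < disk_count (p \Po (c *: 'X)))%N.
Proof.
move=> p0 c1 pz z1; have [r [pE _ -> rE]] := disk_count_neq0 p0.
have zr : z \in r by rewrite -rE.
have c0 : 0 < c by apply: lt_trans c1.
have -> : p \Po (c *: 'X) =
    (lead_coef p * c ^+ size r) *: \prod_(z <- [seq x / c | x <- r]) ('X - z%:P).
  rewrite {1}pE linearZ/= -scalerA; congr (_ *: _).
  rewrite rmorph_prod/= big_map; elim: (r) => [|x s IH].
    by rewrite !big_nil expr0 scale1r.
  have linE : ('X - x%:P) \Po (c *: 'X) = c *: ('X - (x / c)%:P).
    rewrite comp_polyB comp_polyX comp_polyC scalerBr; congr (_ - _).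
    by rewrite -mul_polyC -polyCM mulrC divfK ?gt_eqF.
  by rewrite !big_cons IH linE /= exprS -scalerAl -scalerAr scalerA.
rewrite disk_count_prod; last first.
  by rewrite mulf_neq0 ?lead_coef_eq0 ?expf_neq0 ?gt_eqF.
have cV x : (`|x / c| < 1) = (`|x| < c).
  by rewrite normrM normfV (gtr0_norm c0) ltr_pdivrMr// mul1r.
rewrite count_map; set a := fun z : K => `|z| < 1.
apply: (@leq_trans (count (predU a (pred1 z)) r)).
  have := count_predUI a (pred1 z) r.
  rewrite (_ : count (predI a (pred1 z)) r = 0%N) ?addn0 => [->|].
    by rewrite -addn1 leq_add2l -has_count has_pred1.
  apply/eqP; rewrite -leqn0 leqNgt -has_count; apply/hasPn => x _ /=.
  by apply/negP => /andP[+ /eqP xz]; rewrite /a xz z1 ltxx.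
apply: sub_count => x; rewrite /= /a cV => /orP[|/eqP ->]; last by rewrite z1.
by move/lt_trans; apply.
Qed.

Lemma disk_count_monomial (c : K) n : c != 0 -> disk_count (c *: 'X^n) = n.
Proof.
move=> c0; have -> : 'X^n = \prod_(z <- nseq n (0 : K)) ('X - z%:P) :> {poly K}.
  elim: n => [|n IH]; first by rewrite big_nil expr0.
  by rewrite big_cons exprS IH subr0.
by rewrite disk_count_prod// count_nseq normr0 ltr01 mul1n.
Qed.

End DiskScale.

Lemma homogenize_homog (K : numClosedFieldType) n (f : mpoly 2 K) :
  (mmeasure mdeg f <= n.+1)%N -> homogenize n f \is ishomog1 n mdeg.
Proof.
move=> sf; rewrite /homogenize big_seq; apply: rpred_sum => d df.
apply: dhomogZ; rewrite dhomogX -[X in X == _]/(mdeg _) mdeg_triple.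
have dn : (mdeg d <= n)%N by rewrite -ltnS (leq_trans (msize_mdeg_lt df)).
by rewrite -mdeg_pair subnKC.
Qed.

Section Main.
Variable R : realType.
Local Notation C := [the numClosedFieldType of R[i]].
Local Notation R3 := (R * R * R)%type.
Local Notation "x %:C" := (real_complex R x : C).

(** The restriction of [G] to the disk with parametrization [ul : vl : w]. Nothing is divided by
    [w], so the case w = 0 is included. *)
Definition disk_poly (G : mpoly 3 C) (u v w : C) : {poly C} :=
  mmap polyC (vec3 (u *: 'X) (v *: 'X) w%:P) G.

Lemma horner_disk_poly G u v w l :
  (disk_poly G u v w).[l] = meval (vec3 (u * l) (v * l) w) G.
Proof.
rewrite /disk_poly horner_mmap; apply: meval_eq.
by elim/ord3_ind; rewrite /vec3 !(tnth_nth 0) /= !hornerE.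
Qed.

Lemma size_disk_poly G u v w : (size (disk_poly G u v w) <= mmeasure mdeg G)%N.
Proof.
apply: size_mmap; elim/ord3_ind; rewrite /vec3 (tnth_nth 0)/=.
- by rewrite (leq_trans (size_scale_leq _ _)) ?size_polyX.
- by rewrite (leq_trans (size_scale_leq _ _)) ?size_polyX.
- by rewrite (leq_trans (size_polyC_leq1 _)).
Qed.

Lemma coef_cvg_disk_poly (T : Type) (F : set_system T) {FF : Filter F} G
    (u v w : T -> C) (a b c : C) : u @ F --> a -> v @ F --> b -> w @ F --> c ->
  coef_cvg F (fun t => disk_poly G (u t) (v t) (w t)) (disk_poly G a b c).
Proof.
move=> ua vb wc.
have cvX (h : T -> C) (x : C) : h @ F --> x ->
    coef_cvg F (fun t => h t *: 'X) (x *: 'X).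
  move=> hx i; rewrite coefZ; under eq_cvg do rewrite coefZ.
  exact: (cvgM hx (cvg_cst _)).
have cvC : coef_cvg F (fun t => (w t)%:P) c%:P.
  move=> i; rewrite coefC; under eq_cvg do rewrite coefC.
  by case: eqP => _; [exact: wc | exact: cvg_cst].
apply: (@coef_cvg_mmap C T F FF 3 G
  (fun i t => vec3 (u t *: 'X) (v t *: 'X) (w t)%:P i)
  (vec3 (a *: 'X) (b *: 'X) c%:P)).
by elim/ord3_ind; [exact: (cvX u a ua)|exact: (cvX v b vb)|exact: cvC].
Qed.

(** For the homogenization of [f] this is [beta_poly] cleared of its denominators. As [Num.sqrt] is
    0 on negative reals, its coefficients are continuous on the whole space, in particular across
    the sphere. *)
Definition ball_poly (G : mpoly 3 C) (p : R3) : {poly C} :=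
  disk_poly G p.1.1%:C (Complex p.1.2 p.2 : C) (Num.sqrt (ball_fun p))%:C.

Lemma cvg_coord (p : R3) : [/\ (fun q : R3 => q.1.1) @ nbhs p --> p.1.1,
  (fun q : R3 => q.1.2) @ nbhs p --> p.1.2 & (fun q : R3 => q.2) @ nbhs p --> p.2].
Proof.
case: p => [[x y] z].
split; [| |exact: cvg_snd].
  exact: (cvg_comp _ _ cvg_fst cvg_fst).
exact: (cvg_comp _ _ cvg_fst cvg_snd).
Qed.

Lemma continuous_ball_fun : continuous (@ball_fun R).
Proof.
move=> p; have [cx cy cz] := cvg_coord p.
rewrite /ball_fun; case: p cx cy cz => [[x y] z] /= cx cy cz.
have -> : (fun q : R3 => let '(x, y, z) := q in x - x ^+ 2 - y ^+ 2 - z ^+ 2) =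
  (fun q : R3 => q.1.1 - q.1.1 * q.1.1 - q.1.2 * q.1.2 - q.2 * q.2).
  by apply/funext => -[[a b] c] /=; rewrite !expr2.
exact: (cvgB (cvgB (cvgB cx (cvgM cx cx)) (cvgM cy cy)) (cvgM cz cz)).
Qed.

Lemma open_openB : open (@openB R).
Proof.
have -> : @openB R = @ball_fun R @^-1` [set x | 0 < x] by [].
by apply: open_comp; [move=> p _; exact: continuous_ball_fun | exact: open_gt].
Qed.

Lemma coef_cvg_ball_poly G (p : R3) : coef_cvg (nbhs p) (ball_poly G) (ball_poly G p).
Proof.
have [cx cy cz] := cvg_coord p.
apply: coef_cvg_disk_poly; [exact: cvg_real_complex|exact: cvg_complex|].
apply: cvg_real_complex.
exact: (cvg_comp _ _ (@continuous_ball_fun p) (@sqrt_continuous R _)).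
Qed.

Lemma ball_poly_beta n (f : mpoly 2 C) (p : R3) : (mmeasure mdeg f <= n.+1)%N ->
  openB p -> ball_poly (homogenize n f) p =
    ((Num.sqrt (ball_fun p))%:C) ^+ n *: beta_poly f p.
Proof.
move=> sf pB; apply: poly_horner_inj => l; rewrite hornerZ horner_disk_poly.
have r0 : (Num.sqrt (ball_fun p))%:C != 0.
  by rewrite -[0]/(0%:C) (inj_eq (@complexI _)) gt_eqF// sqrtr_gt0.
rewrite [X in _ = _ * X](_ : _ = meval (affine_point (beta p l)) f); last first.
  exact: horner_beta_poly.
case: p pB r0 => [[x y] z] pB r0.
have mulK (a : C) : a * l = (Num.sqrt (ball_fun (x, y, z)))%:C *
    (a * l / (Num.sqrt (ball_fun (x, y, z)))%:C) by rewrite [RHS]mulrC divfK.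
by apply: (meval_homogenize_unit sf); exact: mulK.
Qed.

Lemma Nf_ball_poly n (f : mpoly 2 C) (p : R3) : (mmeasure mdeg f <= n.+1)%N ->
  openB p -> Nf f p = disk_count (ball_poly (homogenize n f) p).
Proof.
move=> sf pB; rewrite (ball_poly_beta sf pB) disk_countZ//.
by rewrite expf_neq0// -[0]/(0%:C) (inj_eq (@complexI _)) gt_eqF// sqrtr_gt0.
Qed.

(** Hurwitz's theorem for [ball_poly]; it serves both for [p] in the ball and for [p] on the
    sphere. *)
Lemma near_Nf n (f : mpoly 2 C) (p : R3) : (mmeasure mdeg f <= n.+1)%N ->
  ball_poly (homogenize n f) p != 0 ->
  (forall z, root (ball_poly (homogenize n f) p) z -> `|z| != 1) ->
  \forall q \near p, openB q -> Nf f q = disk_count (ball_poly (homogenize n f) p).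
Proof.
move=> sf P0 circ.
have sP q : (size (ball_poly (homogenize n f) q) <= n.+1)%N.
  exact: (leq_trans (size_disk_poly _ _ _ _) (homogenize_deg sf)).
have := disk_count_cvg (FF := nbhs_filter p) P0 (sP p) sP
  (@coef_cvg_ball_poly _ p) circ.
apply: filterS => q [_ e] qB.
by rewrite (Nf_ball_poly sf qB).
Qed.

(** [Nf f] is constant near [p], so [p] is interior to [Sf f k] as soon as it is in its closure. *)
Lemma not_boundary_Sf n (f : mpoly 2 C) (p : R3) k : (mmeasure mdeg f <= n.+1)%N ->
  openB p -> beta_poly f p != 0 -> (forall z, root (beta_poly f p) z -> `|z| != 1) ->
  ~ boundary (Sf f k) p.
Proof.
move=> sf pB P0 circ [clp nip].
have r0 : (Num.sqrt (ball_fun p))%:C ^+ n != 0.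
  by rewrite expf_neq0// -[0]/(0%:C) (inj_eq (@complexI _)) gt_eqF// sqrtr_gt0.
have sE := ball_poly_beta sf pB.
have near_k : \forall q \near p, openB q -> Nf f q = Nf f p.
  rewrite (Nf_ball_poly sf pB).
  apply: (near_Nf sf); first by rewrite sE scaler_eq0 negb_or r0.
  by move=> z; rewrite sE rootZ//; exact: circ.
have nearB : \forall q \near p, openB q.
  by apply: open_nbhs_nbhs; split=> //; exact: open_openB.
have [q [[qB qk] qN]] := clp _ near_k.
apply: nip; apply: filterS2 near_k nearB => q' q'N q'B; split=> //.
by rewrite q'N// -(qN qB).
Qed.

(* At a boundary point of the ball, the rescaled polynomial degenerates to the
   top degree part of f times l ^ n. *)
Lemma sphere_closure_Sf n (f : mpoly 2 C) (p : R3) k : (mmeasure mdeg f <= n.+1)%N ->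
  (k <= n)%N -> ball_fun p = 0 -> closure (Sf f k) p ->
  meval (vec3 p.1.1%:C (Complex p.1.2 p.2 : C) 0) (homogenize n f) = 0.
Proof.
move=> sf kn p0 clp; set c := meval _ _; apply/eqP/negPn/negP => c0.
have PE : ball_poly (homogenize n f) p = c *: 'X^n.
  apply: poly_horner_inj => l; rewrite horner_disk_poly p0 sqrtr0 hornerZ hornerXn.
  rewrite [RHS]mulrC; apply: etrans (meval_homog _ _ (homogenize_homog sf)).
  apply: meval_eq; elim/ord3_ind; rewrite /vec3 !(tnth_nth 0) /= ?mulr0//; exact: mulrC.
have near_n := @near_Nf n f p sf.
(* All [n] roots of the monomial sit at 0, off the circle, so [Nf f] equals [n] on the ball near
   [p], against [Nf f q < k <= n]. *)
have {near_n} near_n : \forall q \near p, openB q -> Nf f q = n.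
  have e := disk_count_monomial n c0; rewrite -PE in e.
  rewrite e in near_n; apply: near_n.
    by rewrite PE scaler_eq0 negb_or c0 -size_poly_eq0 size_polyXn.
  move=> z; rewrite PE rootZ// /root hornerXn expf_eq0 => /andP[_ /eqP ->].
  by rewrite normr0 eq_sym oner_eq0.
have [q [[qB qk] qN]] := clp _ near_n.
by move: qk; rewrite qN// ltnNge kn.
Qed.

(** The points t p with t > 1 that lie in the ball have a larger root count than [p]. They tend to
    [p] as t decreases to 1, so [p] cannot be interior to the set where the count is at most
    [Nf f p]. *)
Lemma circle_root_boundary n (f : mpoly 2 C) (p : R3) z :
  (mmeasure mdeg f <= n.+1)%N -> openB p ->
  beta_poly f p != 0 -> root (beta_poly f p) z -> `|z| = 1 ->
  exists2 k, (1 <= k <= n)%N & boundary (Sf f k) p.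
Proof.
move=> sf pB P0 pz z1.
have sP : (size (beta_poly f p) <= n.+1)%N.
  apply: leq_trans sf; apply: size_mmap => i.
  by rewrite (leq_trans (size_scale_leq _ _)) ?size_polyX.
(* The least index whose set contains [p]; the uncounted root on the circle keeps it at most [n]. *)
exists (Nf f p).+1; first exact: (disk_count_lt P0 sP pz z1).
split; first by apply: subset_closure; split.
pose q (t : R) : R3 := (t * p.1.1, t * p.1.2, t * p.2).
have scale t : 1 < t -> openB (q t) -> (Nf f p < Nf f (q t))%N.
  move=> t1 qB.
  (* The dilation factor in beta (t p) l = beta p (c l). It exceeds 1 because t^2 [ball_fun p] minus
     [ball_fun (q t)] is t x (t - 1), which is positive. *)
  set c := t * Num.sqrt (ball_fun p) / Num.sqrt (ball_fun (q t)).
  have lt_ball : ball_fun (q t) < t ^+ 2 * ball_fun p.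
    move: pB; rewrite /openB /ball_fun /q; case: (p) => [[x y] w] /= xB.
    have x0 : 0 < x by nra.
    have tx : 0 < t * x * (t - 1) by rewrite !mulr_gt0 ?subr_gt0// (lt_trans _ t1).
    by nra.
  have rt0 : 0 < Num.sqrt (ball_fun (q t)) by rewrite sqrtr_gt0.
  have r0 : 0 < Num.sqrt (ball_fun p) by rewrite sqrtr_gt0.
  have t0 : 0 < t by apply: lt_trans t1.
  have c1 : 1 < c.
    rewrite ltr_pdivlMr// mul1r -[t in ltRHS](ger0_norm (ltW t0)) -sqrtr_sqr.
    by rewrite -sqrtrM ?sqr_ge0// ltr_sqrt// mulr_gt0// exprn_gt0.
  have beta_q l : beta (q t) l = beta p (c%:C * l).
    have cE : c%:C = t%:C * (Num.sqrt (ball_fun p))%:C / (Num.sqrt (ball_fun (q t)))%:C.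
      by rewrite /c !rmorphM fmorphV.
    have nz (a : R) : 0 < a -> a%:C != 0.
      by move=> a0; rewrite -[0]/(0%:C) (inj_eq (@complexI _)) gt_eqF.
    move: (nz _ rt0) (nz _ r0); rewrite cE /beta /q; case: (p) => [[x y] w] /=.
    set rt := (Num.sqrt _)%:C; set r := (Num.sqrt _)%:C => rt_neq0 r_neq0.
    have yE : Complex (t * y) (t * w) = t%:C * (Complex y w : C) :> C.
      by apply/eqP; rewrite eq_complex /= !mul0r subr0 addr0 !eqxx.
    by rewrite yE rmorphM; congr (_, _); field; apply/andP.
  have -> : Nf f (q t) = disk_count (beta_poly f p \Po (c%:C *: 'X)).
    congr disk_count; apply: poly_horner_inj => l.
    rewrite horner_comp hornerZ hornerX.
    rewrite [LHS](_ : _ = meval (affine_point (beta (q t) l)) f); last first.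
      exact: horner_beta_poly.
    rewrite beta_q; exact/esym/horner_beta_poly.
  by apply: (disk_count_scale P0 _ pz z1); rewrite -[1]/(1%:C) ltcR.
rewrite /interior => int.
have cvq : q @ 1^'+ --> p.
  apply: cvg_at_right_filter; rewrite /q; case: (p) => [[x y] w] /=.
  have cv (a : R) : (fun t => t * a) @ (1 : R) --> a.
    by rewrite -[X in _ --> X]mul1r; apply: cvgM; [exact: cvg_id | exact: cvg_cst].
  exact: (cvg_pair (cvg_pair (cv x) (cv y)) (cv w)).
have near1 : \forall t \near (1 : R)^'+, Sf f (Nf f p).+1 (q t) := cvq _ int.
have near2 : \forall t \near (1 : R)^'+, 1 < t by exact: nbhs_right_gt.
have FFr : ProperFilter (1 : R)^'+ by exact: at_right_proper_filter.
have [t [[tB tN] t1]] := filter_ex (filterI near1 near2).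
by move: tN; rewrite ltnS leqNgt (scale t t1 tB).
Qed.

End Main.

(** * Plane projective curves *)

Section Locus.
Variable K : numClosedFieldType.
Implicit Types (F : mpoly 3 K) (w : 'I_3 -> K).

Lemma vec_neq0 w : (exists i, w i != 0) -> \row_i w i != 0.
Proof.
by move=> [i wi]; apply/eqP => /rowP/(_ i); rewrite !mxE => /eqP; apply/negP.
Qed.

Definition proj_class w (w0 : exists i, w i != 0) : P2 K :=
  \pi_(P2 K)%qT (exist (fun x : 'rV[K]_3 => x != 0) _ (vec_neq0 w0)).

Lemma proj_class_surj (P : P2 K) :
  exists w (w0 : exists i, w i != 0), P = proj_class w0.
Proof.
have x0 := valP (repr P); set x := val (repr P) in x0.
have w0 : exists i, (fun i => x 0 i) i != 0.
  apply: contrapT => H; case/eqP: x0; apply/rowP => i; rewrite mxE.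
  by apply/eqP/negPn/negP => xi; apply: H; exists i.
exists (fun i => x 0 i), w0.
rewrite -[LHS]reprK /proj_class; congr (\pi_(P2 K)%qT _).
by apply: val_inj; apply/rowP => i; rewrite mxE.
Qed.

(** Homogeneity makes vanishing independent of the representative. *)
Lemma zero_locus_class F d w (w0 : exists i, w i != 0) : F \is ishomog1 d mdeg ->
  zero_locus F (proj_class w0) <-> meval w F = 0.
Proof.
move=> Fh; split=> [|Fw x /eqmodP].
  move=> /(_ _ erefl) <-; apply: meval_eq => i.
  by rewrite mxE.
rewrite /= => /asboolP[c c0 /= e].
have : meval (fun i => c * val x 0 i) F = 0.
  rewrite -Fw; apply: meval_eq => i.
  by have := congr1 (fun m : 'rV_3 => m 0 i) e; rewrite !mxE => ->.
rewrite (meval_homog _ _ Fh) => /eqP.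
by rewrite mulf_eq0 expf_eq0 (negbTE c0) andbF => /eqP.
Qed.

Lemma mpolyX_homog (i : 'I_3) : mpolyX K (mnm1 i) \is ishomog1 1%N mdeg.
Proof. by rewrite dhomogX -[X in X == _]/(mdeg _) mdeg1. Qed.

Lemma line_homog (a : 'rV[K]_3) :
  (\sum_(i < 3) a 0 i *: mpolyX K (mnm1 i)) \is ishomog1 1%N mdeg.
Proof. by apply: rpred_sum => i _; apply: dhomogZ; exact: mpolyX_homog. Qed.

Lemma eq_zero_locus F G d e : F \is ishomog1 d mdeg -> G \is ishomog1 e mdeg ->
  (forall w, meval w F = 0 <-> meval w G = 0) -> zero_locus F = zero_locus G.
Proof.
move=> Fh Gh FG; apply/seteqP; split=> P; have [w [w0 ->]] := proj_class_surj P.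
  by rewrite (zero_locus_class w0 Fh) (zero_locus_class w0 Gh) FG.
by rewrite (zero_locus_class w0 Fh) (zero_locus_class w0 Gh) FG.
Qed.

Lemma vec3_neq0 (u v : K) : exists i, vec3 u v 1 i != 0.
Proof. by exists ord_max; rewrite oner_neq0. Qed.

Lemma affine_chartE (q : K * K) : affine_chart q = proj_class (vec3_neq0 q.1 q.2).
Proof.
rewrite /affine_chart /proj_class; congr (\pi_(P2 K)%qT _).
by apply: val_inj.
Qed.

Lemma meval_line (a : 'rV[K]_3) w :
  meval w (\sum_(i < 3) a 0 i *: mpolyX K (mnm1 i)) = \sum_(i < 3) a 0 i * w i.
Proof. by rewrite rmorph_sum/=; apply: eq_bigr => i _; rewrite mevalZ mevalXU. Qed.

(** [L] is the coefficient vector of the form w_j - s w_i, to which [irreducible_linear] applies. *)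
Lemma line_locus F d (i j : 'I_3) (s : K)
    (L := fun k => if k == j then 1 else if k == i then - s else 0 : K) :
  i != j -> F \is ishomog1 d mdeg ->
  irreducible_elt F -> (forall w, w j = s * w i -> meval w F = 0) ->
  zero_locus F = zero_locus (\sum_(k < 3) (\row_k L k) 0 k *: mpolyX K (mnm1 k)).
Proof.
move=> ij Fh Firr van; apply: (eq_zero_locus Fh (line_homog _)) => w.
rewrite (irreducible_linear ij Firr van) meval_line.
under eq_bigr do rewrite mxE.
rewrite (bigD1 j)//= (bigD1 i)//= /L !eqxx (negbTE ij) mul1r big1 ?addr0; last first.
  by move=> k /andP[/negbTE -> /negbTE ->]; rewrite mul0r.
by rewrite mulNr; split=> [->|/eqP]; [rewrite subrr | rewrite subr_eq0 => /eqP].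
Qed.

End Locus.

(** * The correspondence between alpha and beta on the unit circle *)

Section AlphaBeta.
Variable R : realType.
Local Notation C := [the numClosedFieldType of R[i]].
Local Notation R3 := (R * R * R)%type.
Local Notation "x %:C" := (real_complex R x : C).

Lemma real_complex_neq0 (a : R) : 0 < a -> a%:C != 0.
Proof. by move=> a0; rewrite -[0]/(0%:C) (inj_eq (@complexI _)) gt_eqF. Qed.

Lemma sqr_norm_complex (z : C) : `|z| ^+ 2 = (conjc z : C) * z.
Proof.
rewrite -add_Re2_Im2; case: z => a b; apply/eqP; rewrite eq_complex /= !expr2.
by apply/andP; split; apply/eqP; ring.
Qed.

Lemma norm_conjc (z : C) : `|(conjc z : C)| = `|z|.
Proof. by rewrite !normc_def; case: z => a b /=; rewrite sqrrN. Qed.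

Lemma ball_funE (p : R3) :
  (ball_fun p)%:C = p.1.1%:C - p.1.1%:C ^+ 2 - `|(Complex p.1.2 p.2 : C)| ^+ 2.
Proof.
rewrite -add_Re2_Im2 -rmorphXn -!rmorphB/=; congr (_%:C).
by case: p => [[x y] z] /=; ring.
Qed.

Lemma beta_expand (p : R3) (l : C) : beta p l =
  (p.1.1%:C * l / (Num.sqrt (ball_fun p))%:C,
   (Complex p.1.2 p.2 : C) * l / (Num.sqrt (ball_fun p))%:C).
Proof. by case: p => [[x y] z]. Qed.

Lemma R3_of_eta (p : R3) : R3_of p.1.1%:C (Complex p.1.2 p.2 : C) = p.
Proof. by case: p => [[x y] z]. Qed.

Lemma openB_gt0 (p : R3) : openB p -> 0 < p.1.1.
Proof. by case: p => [[x y] z]; rewrite /openB /ball_fun /= => h; nra. Qed.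

Lemma conjcM (x y : C) : (conjc (x * y) : C) = (conjc x : C) * (conjc y : C).
Proof. exact: (rmorphM (@conjc R)). Qed.

Lemma conjcV (x : C) : (conjc x^-1 : C) = (conjc x : C)^-1.
Proof. exact: conjc_inv. Qed.

Lemma alphaf_vec3E (u v w : C) (s := `|u| ^+ 2 + `|v| ^+ 2 + `|w| ^+ 2) :
  alphaf (vec3 u v w) = R3_of (`|u| ^+ 2 / s) ((conjc u : C) * v / s).
Proof. exact: alphafE. Qed.

Lemma alphaf_vec3 (u v : C) (s := (conjc u : C) * u + (conjc v : C) * v + 1) :
  alphaf (vec3 u v 1) = R3_of ((conjc u : C) * u / s) ((conjc u : C) * v / s).
Proof.
by rewrite alphaf_vec3E /s -!sqr_norm_complex normr1 expr1n.
Qed.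

(** With c = y + iz and r^2 = x - x^2 - |c|^2, the denominator (x^2 + |c|^2) / r^2 + 1 collapses to
    x / r^2. *)
Lemma alphaf_beta (p : R3) (l : C) : openB p -> `|l| = 1 ->
  alphaf (vec3 (beta p l).1 (beta p l).2 1) = p.
Proof.
move=> pB l1; rewrite -[RHS]R3_of_eta beta_expand /=.
have x0 := real_complex_neq0 (openB_gt0 pB).
have r0 : (Num.sqrt (ball_fun p))%:C != 0 by rewrite real_complex_neq0// sqrtr_gt0.
have r2 : (Num.sqrt (ball_fun p))%:C ^+ 2 =
    p.1.1%:C - p.1.1%:C ^+ 2 - `|(Complex p.1.2 p.2 : C)| ^+ 2.
  by rewrite -ball_funE -rmorphXn sqr_sqrtr// ltW.
have rr : (conjc (Num.sqrt (ball_fun p))%:C : C) = (Num.sqrt (ball_fun p))%:C.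
  exact: conjc_real.
have xr : (conjc p.1.1%:C : C) = p.1.1%:C by exact: conjc_real.
have ll : (conjc l : C) * l = 1 by rewrite -sqr_norm_complex l1 expr1n.
rewrite sqr_norm_complex in r2.
move: r0 x0 r2 ll rr xr.
set r := (Num.sqrt _)%:C; set x := _%:C; set c : C := Complex _ _.
move=> r0 x0 r2 ll rr xr.
rewrite alphaf_vec3 !conjcM !conjcV rr xr.
set cc : C := conjc c in r2 *; set cl : C := conjc l in ll *.
have -> : x * cl / r * (x * l / r) + cc * cl / r * (c * l / r) + 1 = x / r ^+ 2.
  rewrite [LHS](_ : _ = (x ^+ 2 + cc * c) * (cl * l) / r ^+ 2 + 1); last by field.
  have -> : x ^+ 2 + cc * c = x - r ^+ 2 by rewrite r2; ring.
  by rewrite ll; field.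
congr R3_of.
  rewrite [LHS](_ : _ = x * (cl * l)); first by rewrite ll mulr1.
  by field; rewrite x0 r0.
rewrite [LHS](_ : _ = c * (cl * l)); first by rewrite ll mulr1.
by field; rewrite x0 r0.
Qed.

(** With a = |u|, b = |v| and s = a^2 + b^2 + 1, [ball_fun p] is a^2 (s - a^2 - b^2) / s^2, that is,
    (a / s)^2, which is positive. *)
Lemma beta_alphaf (u v : C) (p := alphaf (vec3 u v 1)) : u != 0 ->
  openB p /\ beta p (u / `|u|) = (u, v).
Proof.
move=> u0; set a := `|u|; set b := `|v|; set s := a ^+ 2 + b ^+ 2 + 1.
have a0 : 0 < a by rewrite normr_gt0.
have s0 : 0 < s by rewrite ltr_wpDl// addr_ge0// exprn_ge0// normr_ge0.
have pE : p = R3_of (a ^+ 2 / s) ((conjc u : C) * v / s).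
  by rewrite /p alphaf_vec3 /s /a /b !sqr_norm_complex.
have xE : p.1.1%:C = a ^+ 2 / s.
  by rewrite pE; apply: RRe_real; rewrite gtr0_real// divr_gt0// exprn_gt0.
have cE : (Complex p.1.2 p.2 : C) = (conjc u : C) * v / s.
  by rewrite pE /=; case: ((conjc u : C) * v / s).
(* The real number whose image in the complex field is a / s; it is the square root of
   [ball_fun p]. *)
pose rho := complex.Re (a / s).
have rhoE : rho%:C = a / s by rewrite RRe_real// gtr0_real// divr_gt0.
have rho0 : 0 < rho by rewrite -ltcR rhoE divr_gt0.
have ballE : ball_fun p = rho ^+ 2.
  apply: (@complexI R); rewrite [RHS]rmorphXn [LHS]ball_funE xE cE.
  rewrite [X in _ = X ^+ 2]rhoE !normrM normfV norm_conjc (gtr0_norm s0) -/a -/b.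
  by rewrite /s; field; exact: lt0r_neq0.
have pB : openB p by change (0 < ball_fun p); rewrite ballE exprn_gt0.
split=> //; rewrite beta_expand ballE sqrtr_sqr gtr0_norm// rhoE xE cE.
have uu : (conjc u : C) * u = a ^+ 2 by rewrite -sqr_norm_complex.
congr (_, _); first by field; rewrite !lt0r_neq0.
rewrite [LHS](_ : _ = (conjc u : C) * u * v / a ^+ 2); last first.
  by field; rewrite !lt0r_neq0.
by rewrite uu mulrAC divff ?mul1r// expf_neq0// lt0r_neq0.
Qed.

End AlphaBeta.

(** * The two inclusions, for a curve given by a form F *)

Section Curve.
Variables (R : realType).
Local Notation C := [the numClosedFieldType of R[i]].
Local Notation R3 := (R * R * R)%type.
Local Notation "x %:C" := (real_complex R x : C).
Variables (F : mpoly 3 C) (d n : nat) (f : mpoly 2 C).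
Hypothesis Fh : F \is ishomog1 d mdeg.
Hypothesis Firr : irreducible_elt F.
Hypothesis fdeg : mmeasure mdeg f = n.+1.
Hypothesis Ff : forall u v : C,
  meval (vec3 u v 1) F = 0 <-> meval (affine_point (u, v)) f = 0.
Hypothesis not_line : forall a : 'rV[C]_3, a != 0 -> a 0 ord_max = 0 ->
  zero_locus F <> zero_locus (\sum_(i < 3) a 0 i *: mpolyX C (mnm1 i)).
Hypothesis not_infinity : zero_locus F <> @line_at_infinity C.

Let fdeg_le : (mmeasure mdeg f <= n.+1)%N. Proof. by rewrite fdeg. Qed.

Let T : set R3 := \bigcup_(k in [set k | (1 <= k <= n)%N]) boundary (Sf f k).

Lemma affine_zero (w : 'I_3 -> C) : w ord_max != 0 ->
  meval w F = 0 <-> meval (affine_point (w 0 / w ord_max, w 1 / w ord_max)) f = 0.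
Proof.
move=> w2; rewrite -Ff.
have -> : meval w F = w ord_max ^+ d *
    meval (vec3 (w 0 / w ord_max) (w 1 / w ord_max) 1) F.
  rewrite -(meval_homog _ _ Fh); apply: meval_eq; elim/ord3_ind.
  - by rewrite /vec3 (tnth_nth 0)/= mulrC divfK.
  - by rewrite /vec3 (tnth_nth 0)/= mulrC divfK.
  - by rewrite /vec3 (tnth_nth 0)/= mulr1.
split=> [/eqP|->]; last by rewrite mulr0.
by rewrite mulf_eq0 expf_eq0 (negbTE w2) andbF => /eqP.
Qed.

(** If F vanished on w_j = s w_i, irreducibility would make the curve equal to this line. The side
    conditions say that the form has no last coefficient, so the line passes through [0:0:1], which
    [not_line] forbids. *)
Lemma off_line (i j : 'I_3) (s : C) : i != j -> j != ord_max ->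
  i != ord_max \/ s = 0 -> exists2 y, y j = s * y i & meval y F != 0.
Proof.
move=> ij j2 is0; apply: contrapT => H.
have van w : w j = s * w i -> meval w F = 0.
  by move=> wj; apply/eqP/negPn/negP => Fw; apply: H; exists w.
apply: not_line (line_locus ij Fh Firr van).
  by apply/eqP => /rowP/(_ j); rewrite !mxE eqxx => /eqP; rewrite oner_eq0.
rewrite mxE eq_sym (negbTE j2); case: eqP => // i2.
by case: is0 => [|->]; [rewrite -i2 eqxx | rewrite oppr0].
Qed.

Lemma off_infinity : exists2 y, y ord_max = 0 & meval y F != 0.
Proof.
apply: contrapT => H; apply: not_infinity.
have van w : w ord_max = 0 * w 0 -> meval w F = 0.
  by rewrite mul0r => wj; apply/eqP/negPn/negP => Fw; apply: H; exists w.
apply: (eq_zero_locus Fh (mpolyX_homog _ _)) => w.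
by rewrite (@irreducible_linear _ _ F 0 ord_max 0 _ Firr van)// mul0r mevalXU.
Qed.

Lemma poly_eq0_off (p : {poly C}) : (forall x, x != 0 -> p.[x] = 0) -> p = 0.
Proof.
move=> p0; apply/eqP; rewrite -(mulrI_eq0 _ (@mulfI _ 'X _)) ?polyX_eq0//; apply/eqP.
apply: poly_horner_inj => x; rewrite hornerM hornerX horner0.
by have [->|/p0 ->] := eqVneq x 0; rewrite ?mul0r ?mulr0.
Qed.

(** The points [beta p l] sweep out the line v = s u. If [f] vanished on it, F would vanish on the
    projective line w_1 = s w_0, against [off_line]. *)
Lemma beta_poly_neq0 (p : R3) : openB p -> beta_poly f p != 0.
Proof.
move=> pB; apply/eqP => P0.
have x0 := real_complex_neq0 (openB_gt0 pB).
have r0 : (Num.sqrt (ball_fun p))%:C != 0 by rewrite real_complex_neq0// sqrtr_gt0.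
set c : C := Complex p.1.2 p.2; pose s := c / p.1.1%:C.
have [|||y y1] := @off_line 0 1 s => //; first by left.
apply/negP/negPn/eqP.
(* The last coordinate of [y] may be 0, where [f] says nothing directly. Making it a variable t, F
   vanishes for all nonzero t, hence identically in t. *)
pose q := mmap polyC (vec3 (y 0)%:P (y 1)%:P 'X) F.
have qE t : q.[t] = meval (vec3 (y 0) (y 1) t) F.
  rewrite /q horner_mmap; apply: meval_eq; elim/ord3_ind;
  by rewrite /vec3 !(tnth_nth 0)/= ?hornerC ?hornerX.
have -> : meval y F = q.[y ord_max].
  by rewrite qE; apply: meval_eq => i; rewrite vec3_eta.
suff -> : q = 0 by rewrite horner0.
apply: poly_eq0_off => t t0; rewrite qE.
have t0' : vec3 (y 0) (y 1) t ord_max != 0 by [].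
rewrite (affine_zero t0').
(* The parameter l for which [beta p l] is the affine point (y_0 / t, y_1 / t). *)
have := horner_beta_poly f p (y 0 / t * (Num.sqrt (ball_fun p))%:C / p.1.1%:C).
rewrite P0 horner0 => e; rewrite [RHS]e beta_expand; apply: meval_eq => i.
congr (affine_point _ i); rewrite /vec3 !(tnth_nth 0)/= y1 /s -/c.
by congr (_, _); field; rewrite ?r0 ?x0 ?t0.
Qed.

Lemma zero_in_bigcup (w : 'I_3 -> C) : meval w F = 0 -> w 0 != 0 ->
  w ord_max != 0 -> T (alphaf w).
Proof.
move=> Fw w0 w2.
have -> : alphaf w = alphaf (vec3 (w 0 / w ord_max) (w 1 / w ord_max) 1).
  apply: (alphaf_scale w2); elim/ord3_ind.
  - by rewrite /vec3 (tnth_nth 0)/= mulrC divfK.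
  - by rewrite /vec3 (tnth_nth 0)/= mulrC divfK.
  - by rewrite /vec3 (tnth_nth 0)/= mulr1.
set u := w 0 / w ord_max; set v := w 1 / w ord_max.
have u0 : u != 0 by rewrite mulf_neq0 ?invr_eq0.
have [pB pE] := beta_alphaf v u0.
have z1 : `|u / `|u| | = 1 by rewrite normrM normfV normr_id divff// normr_eq0.
have rt : root (beta_poly f (alphaf (vec3 u v 1))) (u / `|u|).
  apply/rootP; have := horner_beta_poly f (alphaf (vec3 u v 1)) (u / `|u|).
  by move=> ->; rewrite pE; exact/(affine_zero w2).
have [k kn bk] := circle_root_boundary fdeg_le pB (beta_poly_neq0 pB) rt z1.
by exists k.
Qed.

Lemma closed_bigcup_boundary : closed T.
Proof.
apply: closed_bigcup.
  by apply: (@sub_finite_set _ _ `I_n.+1); [move=> k /= /andP[_] | exact: finite_II].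
move=> k _; rewrite /boundary setDE; apply: closedI; first exact: closed_closure.
by rewrite closedC; exact: open_interior.
Qed.

(** As the curve is not the line at infinity, a zero at infinity is a limit of zeros off it, and [T]
    is closed. *)
Lemma zero_in_bigcup_finite (w : 'I_3 -> C) : meval w F = 0 -> w 0 != 0 -> T (alphaf w).
Proof.
move=> Fw w0; have [w2|w2] := eqVneq (w ord_max) 0; last exact: zero_in_bigcup.
apply: closed_alphaf; [exact: closed_bigcup_boundary | by exists 0 |] => e e0.
have [y y2 Fy] := off_infinity.
have w00 : 0 < `|w 0| by rewrite normr_gt0.
(* Staying within |w_0| of [w] keeps the first coordinate nonzero. *)
have [e' [e'0 e'e e'w]] : exists e', [/\ 0 < e', e' <= e & e' <= `|w 0|].
  have [le|/ltW ge] := real_leP (gtr0_real e0) (normr_real (w 0)).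
    by exists e.
  by exists `|w 0|.
have [w' [ww' w'2 Fw']] := near_zero_off_hyperplane w2 y2 Fw Fy e'0.
exists w'; first by move=> i; apply: lt_le_trans (ww' i) e'e.
apply: zero_in_bigcup => //; apply/eqP => w'0.
by have := lt_le_trans (ww' 0) e'w; rewrite w'0 sub0r normrN ltxx.
Qed.

(** The same limit argument removes the condition on the first coordinate, since the curve is not
    the line w_0 = 0 through [0:0:1]. *)
Lemma zeros_sub_bigcup (w : 'I_3 -> C) : meval w F = 0 -> (exists i, w i != 0) ->
  T (alphaf w).
Proof.
move=> Fw wn0; have [w0|w0] := eqVneq (w 0) 0; last exact: zero_in_bigcup_finite.
apply: closed_alphaf; [exact: closed_bigcup_boundary | by [] |] => e e0.
have [||| y] := @off_line 1 0 0 => //; first by right.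
rewrite mul0r => y0 Fy.
have [w' [ww' w'0 Fw']] := near_zero_off_hyperplane w0 y0 Fw Fy e0.
by exists w' => //; exact: zero_in_bigcup_finite.
Qed.

(** A form of degree 0 is constant, hence zero or a unit. *)
Lemma degree_gt0 : (0 < d)%N.
Proof.
rewrite lt0n; apply/eqP => d0; have [F0 Fnu _] := Firr.
have Fcst w : meval w F = meval (fun=> 0) F.
  have := meval_homog 0 w Fh; rewrite d0 expr0 mul1r => <-.
  by apply: meval_eq => i; rewrite mul0r.
set c := meval _ F in Fcst.
have FE : F = mpolyC 3 c.
  apply/eqP; rewrite -subr_eq0; apply/negPn/negP => /mpoly_neq0_meval[w].
  by rewrite mevalB mevalC Fcst subrr eqxx.
case/negP: Fnu; rewrite FE; apply: rmorph_unit; rewrite unitfE.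
by apply: contraNneq F0 => c0; rewrite FE c0 mpolyC0.
Qed.

(** Either F(0, t, 1) has a root t, or it is a nonzero constant c; then F(0, 1, t) = c t^d, which
    vanishes at t = 0. The point found has image the origin under alpha. *)
Lemma zero_on_axis : exists w : 'I_3 -> C,
  [/\ exists i, w i != 0, w 0 = 0 & meval w F = 0].
Proof.
pose q := mmap polyC (vec3 0 'X 1) F.
have qE t : q.[t] = meval (vec3 0 t 1) F.
  rewrite /q horner_mmap; apply: meval_eq; elim/ord3_ind;
  by rewrite /vec3 !(tnth_nth 0)/= ?hornerC ?hornerX.
have [/eqP/size_poly1P[c c0 qc]|/closed_rootP[t]] := eqVneq (size q) 1%N; last first.
  by rewrite /root qE => /eqP Ft; exists (vec3 0 t 1); split=> //; exact: vec3_neq0.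
exists (vec3 0 1 0); split; [by exists 1; exact: oner_neq0 | by [] |].
pose p := mmap polyC (vec3 0 1 'X) F.
have pE t : p.[t] = meval (vec3 0 1 t) F.
  rewrite /p horner_mmap; apply: meval_eq; elim/ord3_ind;
  by rewrite /vec3 !(tnth_nth 0)/= ?hornerC ?hornerX.
have : p - c *: 'X^d = 0.
  apply: poly_eq0_off => t t0; rewrite hornerD hornerN hornerZ hornerXn.
  have : q.[t^-1] = c by rewrite qc hornerC.
  rewrite qE => <-; rewrite mulrC -(meval_homog _ _ Fh) pE.
  apply/eqP; rewrite subr_eq0; apply/eqP/meval_eq; elim/ord3_ind;
  by rewrite /vec3 !(tnth_nth 0)/= ?mulr0 ?divff ?mulr1.
move/eqP; rewrite subr_eq0 => /eqP pc.
by rewrite -pE pc hornerZ hornerXn expr0n gtn_eqF ?degree_gt0// mulr0.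
Qed.

Lemma bigcup_sub_zeros (p : R3) : T p ->
  exists w, [/\ exists i, w i != 0, meval w F = 0 & alphaf w = p].
Proof.
move=> [k /andP[k0 kn] bk].
have [pB|pB] := ltP 0 (ball_fun p).
  have [z [pz z1]] : exists z, root (beta_poly f p) z /\ `|z| = 1.
    apply: contrapT => H.
    apply: (not_boundary_Sf fdeg_le pB (beta_poly_neq0 pB) _ bk) => z pz.
    by apply/eqP => z1; apply: H; exists z.
  exists (vec3 (beta p z).1 (beta p z).2 1).
  split; [exact: vec3_neq0| |exact: alphaf_beta].
  apply/Ff; rewrite -surjective_pairing.
  by have := horner_beta_poly f p z; rewrite (rootP pz) => <-.
have clp := bk.1.
(* [Sf f k] lies in the ball, so its closure contains no point where [ball_fun] is negative. *)
have p0 : ball_fun p = 0.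
  apply/le_anti; rewrite pB leNgt; apply/negP => p_lt0.
  have near_neg : \forall q \near p, ball_fun q < 0.
    by have := @continuous_ball_fun R p => /cvgr_lt; apply.
  have [q [[/= qB _] q_lt0]] := clp _ near_neg.
  by have := lt_trans q_lt0 qB; rewrite ltxx.
(* On the sphere x = 0 forces the origin. There [sphere_closure_Sf] only gives vanishing at the zero
   vector, which is no projective point, so [zero_on_axis] supplies one. *)
have [x0|x0] := eqVneq p.1.1 0.
  have -> : p = (0, 0, 0).
    move: p0 x0; rewrite /ball_fun; case: (p) => [[x y] z] /= p0 x0.
    rewrite x0 in p0 *; have yz : y ^+ 2 + z ^+ 2 = 0.
      by move: p0; rewrite expr0n/=; lra.
    move/eqP: yz; rewrite paddr_eq0 ?sqr_ge0// !sqrf_eq0 => /andP[/eqP -> /eqP ->].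
    by [].
  have [w [wn0 w0 Fw]] := zero_on_axis.
  exists w; split=> //.
  have conj0 : (conjc (0 : C) : C) = 0 by exact: conjc0.
  by rewrite alphafE w0 conj0 normr0 expr0n /= !mul0r.
have pG := sphere_closure_Sf fdeg_le kn p0 clp.
have xC : p.1.1%:C != 0 by rewrite -[0]/(0%:C) (inj_eq (@complexI _)).
set c : C := Complex p.1.2 p.2 in pG.
exists (vec3 p.1.1%:C c 0); split.
- by exists 0.
(* The homogenization of [f] is known to vanish at this point at infinity, and F must be shown to.
   Off infinity both vanish exactly where [f] does, so the point is approximated by such common
   zeros. *)
- apply: meval_closed => e e0.
  have [y y2 Gy] := homogenize_infinity fdeg.
  have [w' [ww' w'2 Gw']] := @near_zero_off_hyperplane _ _ _
    (vec3 p.1.1%:C c 0) y ord_max e erefl y2 pG Gy e0.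
  exists w' => //; apply/(affine_zero w'2).
  have GE := @meval_homogenize_unit C n f w'
    (affine_point (w' 0 / w' ord_max, w' 1 / w' ord_max)) fdeg_le.
  have w'E (a : C) : a = w' ord_max * (a / w' ord_max) by rewrite [RHS]mulrC divfK.
  move: Gw'; rewrite GE; [|exact: w'E|exact: w'E].
  by move/eqP; rewrite mulf_eq0 expf_eq0 (negbTE w'2) andbF => /eqP.
(* The equation x^2 + |c|^2 = x of the sphere makes the denominator equal to x, so [x : c : 0] is
   sent to [p]. *)
rewrite -[RHS]R3_of_eta alphaf_vec3E -/c normr0 expr0n addr0.
have xr : (conjc p.1.1%:C : C) = p.1.1%:C by exact: conjc_real.
have e : p.1.1%:C - p.1.1%:C ^+ 2 - `|c| ^+ 2 = 0 by rewrite -ball_funE p0.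
have x2 : `|p.1.1%:C| ^+ 2 = p.1.1%:C ^+ 2 by rewrite sqr_norm_complex xr expr2.
have s : `|p.1.1%:C| ^+ 2 + `|c| ^+ 2 = p.1.1%:C.
  by rewrite x2 -[RHS]subr0 -e; ring.
rewrite s xr x2 expr2 mulfK//; congr R3_of.
by rewrite mulrC mulrA mulVf// mul1r.
Qed.

End Curve.

Theorem theorem3p12 (R : realType) (Z : set (P2 R[i])) (n : nat)
    (f : mpoly 2 R[i])
    (Zcurve : irreducible_projective_curve Z)
    (Zline : forall L : set (P2 R[i]),
       projective_line L -> L (affine_chart (0, 0)) -> Z <> L)
    (Zinfty : Z <> @line_at_infinity R[i])
    (firr : irreducible_elt f)
    (fdeg : mmeasure mdeg f = n.+1)
    (fX : @affine_chart R[i] @^-1` Z = affine_zero_set f) :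
  @alpha_tilde R @` Z
  = \bigcup_(k in [set k | (1 <= k <= n)%N]) boundary (Sf f k).
Proof.
case: Zcurve => d [F [Fh Firr ZF]].
pose C := [the numClosedFieldType of R[i]].
have Ff (u v : C) : meval (vec3 u v 1) F = 0 <-> meval (affine_point (u, v)) f = 0.
  rewrite -(zero_locus_class (K := C) (vec3_neq0 u v) Fh).
  rewrite -(affine_chartE (K := C) (u, v)) -ZF.
  have := congr1 (fun A : set (C * C) => A (u, v)) fX.
  by rewrite /preimage /affine_zero_set /= => ->.
(* A line contains [0:0:1], the class of [affine_chart (0, 0)], when its last coefficient is 0. *)
have not_line (a : 'rV[C]_3) : a != 0 -> a 0 ord_max = 0 ->
    zero_locus F <> zero_locus (\sum_(i < 3) a 0 i *: mpolyX C (mnm1 i)).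
  move=> a0 a2; rewrite -ZF; apply: Zline; first by exists a.
  rewrite (affine_chartE (K := C) (0, 0)).
  apply/(zero_locus_class (K := C) _ (line_homog a)).
  rewrite meval_line big1// => i _.
  by elim/ord3_ind: i; rewrite ?a2 ?mul0r// mulr0.
have not_infinity : zero_locus F <> @line_at_infinity C by rewrite -ZF.
apply/seteqP; split=> [p [P ZP <-]|p Tp].
  have [w [w0 PE]] := proj_class_surj (K := C) P.
  have Fw : meval w F = 0.
    by apply/(zero_locus_class (K := C) w0 Fh); rewrite -PE -ZF.
  rewrite PE [alpha_tilde _](_ : _ = alphaf w); last exact: alpha_tilde_pi.
  exact: (zeros_sub_bigcup Fh Firr fdeg Ff not_line not_infinity Fw w0).
have [w [w0 Fw wp]] := bigcup_sub_zeros Fh Firr fdeg Ff not_line Tp.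
exists (proj_class (K := C) w0).
  by rewrite ZF; apply/(zero_locus_class (K := C) w0 Fh).
by rewrite -wp; exact: alpha_tilde_pi.
Qed.
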